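(* Let $p>1$ and let $V:\mathbb{R}^n\to\mathbb{R}$ be an even, strictly convex, $p$-homogeneous $C^2$ function. Assume that $V$ is unconditional and that the function $$x=(x_1,\dots,x_n)\mapsto V\bigl(x_1^{1/p},\dots,x_n^{1/p}\bigr)$$ is concave on $\mathbb{R}^n_+=\{x: x_i\ge 0,\ 1\le i\le n\}$. Then the inequality $$\int_{\mathbb{R}^n} e^{-\Phi(x)}\,dx\,\Bigl(\int_{\mathbb{R}^n} e^{-\frac{1}{p-1}\Phi^*(\nabla V(x))}\,dx\Bigr)^{p-1}\le\Bigl(\int_{\mathbb{R}^n} e^{-V(x)}\,dx\Bigr)^p \qquad ( * )$$ holds for every unconditional proper convex function $\Phi:\mathbb{R}^n\to(-\infty,+\infty]$. Assume, in addition, that for every coordinate hyperplane $H$ with unit normal $e$, and for every $x'\in H$, the function $\varphi:[0,+\infty)\to\mathbb{R}$, $\varphi(t)=\det D^2V^*(x'+te)$, is decreasing. Then $( * )$ holds for every even proper convex function $\Phi:\mathbb{R}^n\to(-\infty,+\infty]$.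
   Context: $\Phi^*(y)=\sup_{x\in\mathbb{R}^n}(\langle x,y\rangle-\Phi(x))$ is the Legendre transform. $V$ is $p$-homogeneous if $V(tx)=t^pV(x)$ for all $t\ge 0$ and $x\in\mathbb{R}^n$. A function is unconditional if $f(\pm x_1,\dots,\pm x_n)=f(x_1,\dots,x_n)$ for all choices of signs. A convex function is proper if it is not identically $+\infty$. ''Decreasing'' means non-increasing. The function $\det D^2V^*$ is the density of the image of Lebesgue measure under $\nabla V$. Conventions: $e^{-\infty}=0$, $0\cdot\infty=0$. *)

(* Defs.v *)
From HB Require Import structures.
From mathcomp Require Import all_boot all_order all_algebra.
From mathcomp Require Import all_classical all_reals all_analysis.
From mathcomp Require Import measurable_realfun.

Set Implicit Arguments.
Unset Strict Implicit.
Unset Printing Implicit Defensive.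

Import Order.TTheory GRing.Theory Num.Theory.
Import numFieldNormedType.Exports.

Local Open Scope classical_set_scope.
Local Open Scope ring_scope.

(* R^n is 'rV[R]_n; its library norm is the max norm, so only topological and
   differential notions are taken from it. *)

Definition rV_display : measure_display -> measure_display.
Proof. exact. Qed.

Section rV_measurable.
Context {R : realType} {n : nat}.

Let coor (i : 'I_n) (x : 'rV[R]_n) : R := x 0 i.

Let rV_set0 : g_sigma_preimage coor set0.
Proof. exact: sigma_algebra0. Qed.

Let rV_setC A : g_sigma_preimage coor A -> g_sigma_preimage coor (~` A).
Proof. exact: sigma_algebraC. Qed.

Let rV_bigcup (F : _^nat) : (forall i, g_sigma_preimage coor (F i)) ->
  g_sigma_preimage coor (\bigcup_i (F i)).
Proof. exact: sigma_algebra_bigcup. Qed.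

(* The sigma-algebra generated by the coordinates is the Borel sigma-algebra
   of R^n. *)
HB.instance Definition _ := @isMeasurable.Build
  (rV_display default_measure_display) 'rV[R]_n (g_sigma_preimage coor) rV_set0 rV_setC rV_bigcup.

Lemma measurable_coor (i : 'I_n) :
  measurable_fun [set: 'rV[R]_n] (fun x : 'rV[R]_n => x 0 i).
Proof.
move=> _ Y mY; rewrite setTI; apply: sub_sigma_algebra => /=.
rewrite -bigcup_seq/=; exists i => /=; first by rewrite mem_index_enum.
by exists Y => //; rewrite setTI.
Qed.

Lemma measurable_fun_coorP d (T : measurableType d) (f : T -> 'rV[R]_n) :
  (forall i, measurable_fun [set: T] (fun t => f t 0 i)) ->
  measurable_fun [set: T] f.
Proof.
move=> mf _ A mA; rewrite setTI.
suff : g_sigma_preimage coor `<=` [set B | measurable (f @^-1` B)] by apply.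
apply: smallest_sub.
  split=> /=.
  - by rewrite preimage_set0.
  - by move=> B /= mB; rewrite setTD preimage_setC; exact: measurableC.
  - by move=> F /= mF; rewrite preimage_bigcup; exact: bigcupT_measurable.
rewrite -bigcup_seq => B [i _ [C mC <-]] /=.
by have := mf i measurableT C mC; rewrite !setTI.
Qed.

End rV_measurable.

Section lebesgue_rV.
Context {R : realType}.

Definition rV_cons n (z : measurableTypeR R * 'rV[R]_n) : 'rV[R]_n.+1 :=
  \row_i (if unlift ord0 i is Some j then z.2 0 j else z.1).

Lemma rV_cons0 n z : @rV_cons n z 0 0 = z.1.
Proof. by rewrite mxE unlift_none. Qed.

Lemma rV_consS n z i : @rV_cons n z 0 (lift ord0 i) = z.2 0 i.
Proof. by rewrite mxE liftK. Qed.

Lemma measurable_rV_cons n : measurable_fun setT (@rV_cons n).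
Proof.
apply: measurable_fun_coorP => i.
case: (unliftP ord0 i) => [j|] ->.
  under eq_fun do rewrite rV_consS.
  by apply: (measurableT_comp (measurable_coor j)); exact: measurable_snd.
under eq_fun do rewrite rV_cons0.
exact: measurable_fst.
Qed.

HB.instance Definition _ n :=
  @isMeasurableFun.Build _ _ _ _ (@rV_cons n) (@measurable_rV_cons n).

Definition rV_uncons n (x : 'rV[R]_n.+1) : measurableTypeR R * 'rV[R]_n :=
  (x 0 0, \row_j x 0 (lift ord0 j)).

Lemma measurable_rV_uncons n : measurable_fun setT (@rV_uncons n).
Proof.
apply/measurable_fun_pair; first exact: measurable_coor.
apply: measurable_fun_coorP => i; under eq_fun do rewrite mxE.
exact: measurable_coor.
Qed.

Lemma rV_consK n : cancel (@rV_cons n) (@rV_uncons n).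
Proof.
move=> [a x]; rewrite /rV_uncons rV_cons0; congr pair.
by apply/rowP => j; rewrite mxE rV_consS.
Qed.

Section step.
Variables (n : nat) (m : {sigma_finite_measure set 'rV[R]_n -> \bar R}).

Definition lebesgue_rV_step :=
  pushforward (@lebesgue_measure R \x m)%E (@rV_cons n).

Let step0 : lebesgue_rV_step set0 = 0%E.
Proof. exact: measure0. Qed.

Let step_ge0 A : (0 <= lebesgue_rV_step A)%E.
Proof. exact: measure_ge0. Qed.

Let step_sigma_additive : semi_sigma_additive lebesgue_rV_step.
Proof. exact: measure_semi_sigma_additive. Qed.

HB.instance Definition _ := isMeasure.Build _ _ _
  lebesgue_rV_step step0 step_ge0 step_sigma_additive.

Let step_sigma_finite : sigma_finite setT lebesgue_rV_step.
Proof.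
have /sigma_finiteP[F [TF ndF Foo]] := sigma_finiteT (@lebesgue_measure R).
have /sigma_finiteP[G [TG ndG Goo]] := sigma_finiteT m.
exists (fun k => @rV_uncons n @^-1` (F k `*` G k)).
  rewrite -preimage_bigcup; apply/esym/seteqP; split=> // x _ /=.
  have [k _ Fk] : (\bigcup_k F k) (x 0 0) by rewrite -TF.
  have [l _ Gl] : (\bigcup_k G k) (rV_uncons x).2 by rewrite -TG.
  exists (maxn k l) => //; split => /=.
    by move: Fk; exact/subsetPset/ndF/leq_maxl.
  by move: Gl; exact/subsetPset/ndG/leq_maxr.
move=> k; have [mF Fk] := Foo k; have [mG Gk] := Goo k; split.
  rewrite -[X in measurable X]setTI; apply: measurable_rV_uncons => //.
  exact: measurableX.
rewrite /lebesgue_rV_step /pushforward -comp_preimage.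
rewrite (_ : _ \o _ = id); last exact/funext/rV_consK.
rewrite preimage_id (product_measure1E (@lebesgue_measure R) m)//.
by rewrite lte_mul_pinfty// ge0_fin_numE.
Qed.

HB.instance Definition _ := @Measure_isSigmaFinite.Build _ _ _
  lebesgue_rV_step step_sigma_finite.

End step.

Fixpoint lebesgue_rV n : {sigma_finite_measure set 'rV[R]_n -> \bar R} :=
  match n with
  | 0 => \d_(0 : 'rV[R]_0)
  | k.+1 => lebesgue_rV_step (lebesgue_rV k)
  end.

Lemma measurable_rV_box n (A : 'I_n -> set R) : (forall i, measurable (A i)) ->
  measurable [set x : 'rV[R]_n | forall i, A i (x 0 i)].
Proof.
move=> mA; have -> : [set x : 'rV[R]_n | forall i, A i (x 0 i)] =
    \bigcap_(i in [set: 'I_n]) [set x : 'rV[R]_n | A i (x 0 i)].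
  by apply/seteqP; split => x /= H i; [move=> _|]; exact: H.
apply: fin_bigcap_measurable => // i _.
by rewrite -[X in measurable X]setTI; exact: measurable_coor.
Qed.

Lemma lebesgue_rV_box n (A : 'I_n -> set R) : (forall i, measurable (A i)) ->
  lebesgue_rV n [set x | forall i, A i (x 0 i)] =
  (\prod_(i < n) @lebesgue_measure R (A i))%E.
Proof.
elim: n A => [|n ih] A mA /=.
  by rewrite big_ord0 diracE mem_set// => -[].
rewrite big_ord_recl -ih// /lebesgue_rV_step /pushforward.
rewrite -(product_measure1E (@lebesgue_measure R) (lebesgue_rV n))//.
- congr (product_measure1 _ _ _); apply/seteqP; split => -[a x] /= H.
    split; first by have := H 0; rewrite rV_cons0.
    by move=> i; have := H (lift ord0 i); rewrite rV_consS.
  case: H => Aa Ax i; case: (unliftP ord0 i) => [j|] ->.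
    by rewrite rV_consS.
  by rewrite rV_cons0.
- exact: mA.
- exact: (@measurable_rV_box _ (fun i => A (lift ord0 i))).
Qed.

End lebesgue_rV.

Section convexity.
Context {R : realType} {n : nat}.
Implicit Types (V : 'rV[R]_n -> R) (Phi : 'rV[R]_n -> \bar R).

Definition even_fun {T : Type} (f : 'rV[R]_n -> T) := forall x, f (- x) = f x.

Definition unconditional {T : Type} (f : 'rV[R]_n -> T) :=
  forall (s : 'I_n -> bool) (x : 'rV[R]_n),
    f (\row_i ((-1) ^+ s i * x 0 i)) = f x.

Definition homogeneous (p : R) V :=
  forall (t : R) (x : 'rV[R]_n), 0 <= t -> V (t *: x) = t `^ p * V x.

Definition strictly_convex V :=
  forall (x y : 'rV[R]_n) (t : R), x != y -> 0 < t -> t < 1 ->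
    V (t *: x + (1 - t) *: y) < t * V x + (1 - t) * V y.

Definition nonneg_orthant : set 'rV[R]_n := [set x | forall i, 0 <= x 0 i].

Definition concave_on (D : set 'rV[R]_n) V :=
  convex_function D (fun x => - V x : R^o).

(* Convex, with values in (-oo, +oo], not identically +oo; 0 * +oo = 0. *)
Definition proper_convex Phi :=
  [/\ forall x, (-oo < Phi x)%E,
      exists x, (Phi x < +oo)%E &
      forall (x y : 'rV[R]_n) (t : R), 0 <= t -> t <= 1 ->
        (Phi (t *: x + (1 - t) *: y)%R <=
          t%:E * Phi x + (1 - t)%R%:E * Phi y)%E].

Definition dotmul (x y : 'rV[R]_n) : R := \sum_i x 0 i * y 0 i.

Definition legendre Phi (y : 'rV[R]_n) : \bar R :=
  ereal_sup (range (fun x => ((dotmul x y)%:E - Phi x)%E)).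

End convexity.

Section differentiation.
Context {R : realType} {n : nat}.
Implicit Types f : 'rV[R]_n -> R.

Definition basis_vec (i : 'I_n) : 'rV[R]_n := delta_mx 0 i.

Definition partial (i : 'I_n) f (x : 'rV[R]_n) : R := 'D_(basis_vec i) f x.

Definition grad f (x : 'rV[R]_n) : 'rV[R]_n := \row_i partial i f x.

Definition hessian f (x : 'rV[R]_n) : 'M[R]_n :=
  \matrix_(i, j) partial i (partial j f) x.

Definition C1 f :=
  forall i, (forall x, derivable f x (basis_vec i)) /\
            continuous (partial i f).

Definition C2 f := continuous f /\ C1 f /\ forall i, C1 (partial i f).

Definition twice_differentiable f (y : 'rV[R]_n) :=
  (\forall z \near y, differentiable f z) /\ differentiable (grad f) y.

End differentiation.

Section functional_inequality.
Context {R : realType} {n : nat}.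

(* D is "det D^2 V^*": the density of the image of Lebesgue measure under
   grad V, which is also the determinant of the Hessian of V^* at each point
   where V^* is twice differentiable (V^* is finite for the V considered here,
   so fine is harmless).  V^* need not be twice differentiable everywhere, and
   for p > 2 the function det D^2 V^* is homogeneous of negative degree, hence
   unbounded near 0: D takes values in [0, +oo]. *)
Definition is_det_hessian_legendre (V : 'rV[R]_n -> R)
    (D : 'rV[R]_n -> \bar R) :=
  let Vstar (y : 'rV[R]_n) : R := fine (legendre (EFin \o V) y) in
  [/\ measurable_fun [set: 'rV[R]_n] D,
      forall y, (0 <= D y)%E,
      forall y, twice_differentiable Vstar y ->
        D y = (\det (hessian Vstar y))%:E &
      forall A : set 'rV[R]_n, measurable A ->
        pushforward (lebesgue_rV n) (grad V) A =
        (\int[lebesgue_rV n]_(y in A) D y)%E].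

Definition decreasing_off_coordinate_hyperplanes (D : 'rV[R]_n -> \bar R) :=
  forall (i : 'I_n) (x' : 'rV[R]_n), x' 0 i = 0 ->
  forall s t : R, 0 <= s -> s <= t ->
    (D (x' + t *: basis_vec i)%R <= D (x' + s *: basis_vec i)%R)%E.

Local Open Scope ereal_scope.

(* The product and powers follow 0 * +oo = 0, and expeR -oo = 0.  The integral
   of a nonnegative function is the supremum of the integrals of the Borel
   simple functions below it; a convex Phi may fail to be Borel (only) on the
   boundary of its domain, a Lebesgue-null set, which does not affect it. *)
Definition weighted_santalo (p : R) (V : 'rV[R]_n -> R)
    (Phi : 'rV[R]_n -> \bar R) : Prop :=
  (\int[lebesgue_rV n]_x expeR (- Phi x)) *
  (\int[lebesgue_rV n]_x
     expeR (- ((p - 1)^-1%R%:E * legendre Phi (grad V x)))) `^ (p - 1)%R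
  <= (\int[lebesgue_rV n]_x expeR (- (V x)%:E)) `^ p.

End functional_inequality.

(* Main.v *)
(* L denotes the Legendre transform.

   Unconditional case.  With z_i = x_i^(1/p) y_i^(1-1/p) on the positive
   orthant, concavity and 1-homogeneity of W(u) = V(u^(1/p)) give
   p V(z) <= <x, grad V(y)> <= Phi(x) + (L Phi)(grad V(y)), and the
   multiplicative Prekopa-Leindler inequality with exponents 1/p and 1 - 1/p
   concludes.

   Even case.  Write the second integral as an integral of
   exp(-b/(p-1)) D with b = L Phi and D = det D^2 V^*, and symmetrize b in each
   coordinate: (S_i b)(y) is the infimum of (b(y',t1) + b(y',t2))/2 over
   t1 - t2 = 2 y_i.  On lines parallel to e_i the one-dimensional
   Prekopa-Leindler inequality, restricted to the intervals {D > t}, shows that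
   the weighted integral of exp(-b/(p-1)) does not decrease; on slices
   {x_i = s}, the inequality
   L(S_i b)(s, (x + x')/2) <= (L b(s, x) + L b(-s, x'))/2, together with
   evenness, shows that the integral of exp(-L b) does not decrease.  After all
   the coordinates have been treated, L b is unconditional. *)
From HB Require Import structures.
Require Import Defs.
From mathcomp Require Import all_boot all_order all_algebra.
From mathcomp Require Import all_classical all_reals all_analysis.
From mathcomp Require Import measurable_realfun ring lra.
Import Order.TTheory GRing.Theory Num.Theory.
Import numFieldNormedType.Exports.
Local Open Scope classical_set_scope.
Local Open Scope ring_scope.

Set Implicit Arguments.
Unset Strict Implicit.
Unset Printing Implicit Defensive.

(** * Integrals *)

(** When b is the convex indicator of a convex body, S_i b is that of its Steiner symmetral; the
    symmetrization acts on b = L Phi rather than on Phi because the weight D lives in the dual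
    variable. Two obstacles shape the details. First, Phi and S_i b need not be Borel. Integrals are
    therefore bounded through simple functions below the integrand, and S_i b is replaced by its
    double Legendre transform, which is always Borel; only L (L f) <= f is used, and each such
    replacement moves the inequality in the favourable direction. Second, D is tied to V mainly
    through integrals over Borel sets, so its symmetry at each point is not at hand, and its
    decrease is assumed only along positive directions from the coordinate hyperplanes. D(|y|) takes
    its place: it has the same integrals over Borel sets, is unconditional, and decreases in every
    |y_i|. *)

Definition image_measure d d' (T1 : measurableType d) (T2 : measurableType d')
    (R : realType) (m : {measure set T1 -> \bar R}) (f : T1 -> T2)
    (mf : measurable_fun [set: T1] f) : {measure set T2 -> \bar R} :=
  measure_function_pushforward__canonical__measure_function_Measure m mf.

Section integral_facts.
Context d (T : measurableType d) (R : realType).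
Variable mu : {measure set T -> \bar R}.
Local Open Scope ereal_scope.

Import HBNNSimple.

(* The integral is a supremum over simple functions, so that f and g may be
   non-measurable. *)
Lemma ge0_le_integralT (f g : T -> \bar R) : (forall x, 0 <= f x) ->
  (forall x, f x <= g x) -> \int[mu]_x f x <= \int[mu]_x g x.
Proof.
move=> f0 fg; have g0 x : 0 <= g x by exact: le_trans (fg x).
rewrite !ge0_integralTE//; apply: le_ereal_sup => _ [h /= hf <-].
by exists h => //= x; exact: le_trans (fg x).
Qed.

Lemma lt_integral_nnsfun (f : T -> \bar R) (r : \bar R) :
  (forall x, 0 <= f x) -> r < \int[mu]_x f x ->
  exists h : {nnsfun T >-> R},
    (forall x, (h x)%:E <= f x) /\ r < \int[mu]_x (h x)%:E.
Proof.
move=> f0; rewrite ge0_integralTE// => /ereal_sup_gt[_ [h /= hf <-] rh].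
by exists h; split=> //; rewrite integralT_nnsfun.
Qed.

End integral_facts.

(** * The layer cake formula with a weight *)

Section layer_cake.
Context d (T : measurableType d) (R : realType).
Variable m : {sigma_finite_measure set T -> \bar R}.
Local Open Scope ereal_scope.
Local Notation leb := (@lebesgue_measure R).

Lemma measurable_superlevel (f : T -> \bar R) : measurable_fun setT f ->
  forall t : R, measurable [set x | (0 < t)%R /\ t%:E < f x].
Proof.
move=> mf t; case: (ltP 0%R t) => t0.
  rewrite (_ : [set _ | _] = setT `&` [set x | t%:E < f x]); last first.
    by apply/seteqP; split => x //= [].
  exact: emeasurable_fun_o_infty.
by rewrite (_ : [set _ | _] = set0)// -subset0 => x [].
Qed.

Let S (f : T -> \bar R) :=
  [set z : measurableTypeR R * T | (0 < z.1)%R /\ z.1%:E < f z.2].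

Let measurable_S f : measurable_fun setT f -> measurable (S f).
Proof.
move=> mf.
rewrite (_ : S f = [set z | (0 < z.1)%R] `&` [set z | z.1%:E < f z.2]);
  last first.
  by apply/seteqP; split => z.
apply: measurableI.
  rewrite [X in measurable X](_ : _ = fst @^-1` `]0%R, +oo[); last first.
    by apply/seteqP; split => z /=; rewrite in_itv/= andbT.
  rewrite -[X in measurable X]setTI; exact: measurable_fst.
rewrite -[X in measurable X]setTI; apply: emeasurable_fun_lt => //.
  by apply/measurable_EFinP; exact: measurable_fst.
by apply: measurableT_comp => //; exact: measurable_snd.
Qed.

Let h (f w : T -> \bar R) (z : measurableTypeR R * T) :=
  w z.2 * (\1_(S f) z)%:E.

Let measurable_h f w : measurable_fun setT f -> measurable_fun setT w ->
  measurable_fun setT (h f w).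
Proof.
move=> mf mw; apply: emeasurable_funM.
  by apply: measurableT_comp => //; exact: measurable_snd.
by apply/measurable_EFinP/measurable_indic; exact: measurable_S.
Qed.

Let layerE f w (t : R) :
  \int[m]_(x in [set x | (0 < t)%R /\ t%:E < f x]) w x =
  \int[m]_x h f w (t, x).
Proof.
rewrite [LHS]integral_mkcond; apply: eq_integral => x _.
rewrite /h patchE indicE; case: ifPn => /=.
  by rewrite !inE => Sx; rewrite mem_set ?mule1.
by rewrite notin_setE => Sx; rewrite memNset ?mule0.
Qed.

Lemma measurable_layer (f w : T -> \bar R) :
  measurable_fun setT f -> measurable_fun setT w -> (forall x, 0 <= w x) ->
  measurable_fun setT (fun t : R =>
    \int[m]_(x in [set x | (0 < t)%R /\ t%:E < f x]) w x).
Proof.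
move=> mf mw w0; under eq_fun do rewrite layerE.
apply: (measurable_fun_fubini_tonelli_F (h f w)); first exact: measurable_h.
by move=> z; rewrite mule_ge0// lee_fin.
Qed.

(** Tonelli on the region under the graph of [f], weighted by [w]. The condition 0 < t inside the
    layers makes them empty for t <= 0, so that the outer integral can run over the whole line. *)
Lemma layer_cake (f w : T -> \bar R) :
  measurable_fun setT f -> measurable_fun setT w ->
  (forall x, 0 <= f x) -> (forall x, 0 <= w x) ->
  \int[m]_x (w x * f x) =
  \int[leb]_t \int[m]_(x in [set x | (0 < t)%R /\ t%:E < f x]) w x.
Proof.
move=> mf mw f0 w0; under [RHS]eq_integral do rewrite layerE.
rewrite (fubini_tonelli (h f w)); last 2 first.
- exact: measurable_h.
- by move=> z; rewrite mule_ge0// lee_fin.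
apply: eq_integral => x _.
rewrite /h /= ge0_integralZl//; last first.
  by apply/measurable_EFinP/(measurableT_comp (measurable_indic (measurable_S
    mf))); exact: measurable_pair2.
congr (_ * _).
pose A := [set t : R | (0 < t)%R /\ t%:E < f x].
transitivity (\int[leb]_t (\1_A t)%:E); last first.
  by apply: eq_integral => t _; rewrite !indicE; congr (nat_of_bool _)%:R%:E;
    apply/idP/idP; rewrite !inE.
have E1 : A = [set` Interval (BRight 0%R) (if f x is r%:E then BLeft r else
  +oo%O)].
  apply/seteqP; rewrite /A; split => t /=; case: (f x) (f0 x) => [r| |]//=;
    rewrite ?in_itv/= ?lte_fin.
  - by move=> _ [-> ->].
  - by move=> _ [->].
  - by move=> _ /andP[].
  - by move=> _ /andP[-> _]; rewrite ltry.
rewrite E1 integral_indic// setIT; apply/esym;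
  rewrite [LHS]lebesgue_measure_itv/=.
case: (f x) (f0 x) => [r| |]//=; rewrite ?lte_fin ?ltry.
  rewrite lee_fin le_eqVlt => /predU1P[<-|->]; first by rewrite ltxx.
  by rewrite oppr0 adde0.
by rewrite oppr0 adde0.
Qed.

End layer_cake.

(** * Weighted geometric means in [0, +oo] *)

Section poweR_facts.
Context {R : realType}.
Variables a b : R.
Hypotheses (a0 : 0 < a) (b0 : 0 < b) (ab1 : a + b = 1).
Local Open Scope ereal_scope.

(** Passage to the limit from below. Positive real r and s stay away from the value +oo and from the
    convention 0 * +oo = 0, at which the product is not continuous. *)
Lemma lee_poweR2M_lt (x y z : \bar R) : 0 <= x -> 0 <= y -> 0 <= z ->
  (forall r s : R, (0 < r)%R -> (0 < s)%R -> r%:E < x -> s%:E < y ->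
    (r `^ a * s `^ b)%:E <= z) ->
  x `^ a * y `^ b <= z.
Proof.
move=> x0 y0 z0 H.
have aN0 : a != 0%R by rewrite gt_eqF.
have bN0 : b != 0%R by rewrite gt_eqF.
move: x0; rewrite le_eqVlt => /predU1P[<-|x0]; first by rewrite poweR0r// mul0e.
move: y0; rewrite le_eqVlt => /predU1P[<-|y0]; first by rewrite poweR0r// mule0.
have ex_lt (u : \bar R) : 0 < u -> exists2 r : R, (0 < r)%R & r%:E < u.
  case: u => [u|_|//]; last by exists 1%R => //; rewrite ltry.
  rewrite lte_fin => u0; exists (u / 2)%R; first by rewrite divr_gt0.
  by rewrite lte_fin ltr_pdivrMr// ltr_pMr// ltr1n.
case: z z0 H => [z|_ _|//]; last by rewrite leey.
rewrite lee_fin => z0 H.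
case: x x0 H => [x|_|//]; last first.
  move=> H; have [s s0 sy] := ex_lt _ y0.
  have sb0 : (0 < s `^ b)%R by rewrite powR_gt0.
  (* This r solves r^a s^b = z + 1, which contradicts the bound by z. *)
  have := H (((z + 1) / s `^ b) `^ a^-1)%R s.
  rewrite ltry powR_gt0; last by rewrite divr_gt0// ltr_wpDl.
  rewrite -powRrM mulVf// powRr1; last by rewrite divr_ge0 ?powR_ge0// addr_ge0.
  rewrite divfK ?gt_eqF// => /(_ isT s0 isT sy).
  by rewrite lee_fin gerDl ler10.
case: y y0 => [y|_|//]; last first.
  move=> x0 H; have [r r0 rx] := ex_lt _ x0.
  have sb0 : (0 < r `^ a)%R by rewrite powR_gt0.
  have := H r (((z + 1) / r `^ a) `^ b^-1)%R.
  rewrite ltry powR_gt0; last by rewrite divr_gt0// ltr_wpDl.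
  rewrite -powRrM mulVf// powRr1; last by rewrite divr_ge0 ?powR_ge0// addr_ge0.
  rewrite [(r `^ a * _)%R]mulrC divfK ?gt_eqF// => /(_ r0 isT rx isT).
  by rewrite lee_fin gerDl ler10.
rewrite !lte_fin => y0 x0 H; rewrite !poweR_EFin -EFinM lee_fin.
set P := (x `^ a * y `^ b)%R; rewrite leNgt; apply/negP => zP.
have [w zw wP] : exists2 w, (z < w)%R & (w < P)%R.
  by exists ((z + P) / 2)%R; rewrite (midf_lt zP).
have P0 : (0 < P)%R by rewrite mulr_gt0// powR_gt0.
have w0 : (0 < w)%R by exact: le_lt_trans zw.
(* As a + b = 1, shrinking both x and y by the factor c shrinks the product P to w, which still
   exceeds z. *)
pose c : R := (w / P)%R.
have c0 : (0 < c)%R by rewrite divr_gt0.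
have c1 : (c < 1)%R by rewrite ltr_pdivrMr// mul1r.
have := H (c * x)%R (c * y)%R (mulr_gt0 c0 x0) (mulr_gt0 c0 y0).
rewrite !lte_fin !gtr_pMl// => /(_ c1 c1).
rewrite (powRM _ (ltW c0) (ltW x0)) (powRM _ (ltW c0) (ltW y0)) mulrACA -powRD;
  last by rewrite ab1 oner_eq0.
have cP : (c * P = w)%R by rewrite /c divfK ?gt_eqF.
by rewrite ab1 (powRr1 (ltW c0)) cP lee_fin leNgt zw.
Qed.

Lemma lee_poweR2M (x x' y y' : \bar R) : 0 <= x -> 0 <= y ->
  x <= x' -> y <= y' -> x `^ a * y `^ b <= x' `^ a * y' `^ b.
Proof.
move=> x0 y0 xx' yy'.
have mono (c : R) (u v : \bar R) : (0 < c)%R -> 0 <= u -> u <= v -> u `^ c <=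
  v `^ c.
  move=> c0 u0 uv; apply: gt0_ler_poweR => //; first exact: ltW.
    by rewrite in_itv/= u0 leey.
  by rewrite in_itv/= (le_trans u0 uv) leey.
by rewrite lee_pmul ?poweR_ge0//; exact: mono.
Qed.

Lemma poweR_AM_GM (x y : \bar R) : 0 <= x -> 0 <= y ->
  x `^ a * y `^ b <= a%:E * x + b%:E * y.
Proof.
case: x => [x| |]//; last first.
  case: y => [y| |]// _ y0; rewrite gt0_muley ?lte_fin// addye ?leey//.
  - by rewrite gt0_muley.
case: y => [y| |]//; last first.
  by move=> _ _; rewrite [b%:E * _]gt0_muley ?lte_fin// addey ?leey.
rewrite !lee_fin => x0 y0.
have := @conjugate_powR _ (x `^ a)%R (y `^ b)%R a^-1%R b^-1%R (powR_ge0 _ _)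
  (powR_ge0 _ _).
rewrite !invr_gt0 !invrK a0 b0 -!powRrM !mulfV ?gt_eqF// !powRr1//.
by move=> /(_ isT isT ab1); rewrite [(x * a)%R]mulrC [(y * b)%R]mulrC.
Qed.

Import HBNNSimple.

(** Simple functions bring measurability and boundedness at once; boundedness and positive integrals
    are what allows division by suprema in the one-dimensional inequality. *)
Lemma poweR_integral_nnsfun d (T : measurableType d)
    (mu : {measure set T -> \bar R}) (f g : T -> \bar R) (z : \bar R) :
  (forall x, 0 <= f x) -> (forall x, 0 <= g x) -> 0 <= z ->
  (forall u v : {nnsfun T >-> R},
    (forall x, (u x)%:E <= f x) -> (forall x, (v x)%:E <= g x) ->
    0 < \int[mu]_x (u x)%:E -> 0 < \int[mu]_x (v x)%:E ->
    (\int[mu]_x (u x)%:E) `^ a * (\int[mu]_x (v x)%:E) `^ b <= z) ->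
  (\int[mu]_x f x) `^ a * (\int[mu]_x g x) `^ b <= z.
Proof.
move=> f0 g0 z0 H; apply: lee_poweR2M_lt => //; try exact: integral_ge0.
move=> r s r0 s0 /(lt_integral_nnsfun f0)[u [uf ru]].
move=> /(lt_integral_nnsfun g0)[v [vg sv]].
apply: le_trans (H _ _ uf vg _ _).
- rewrite EFinM -!poweR_EFin; apply: lee_poweR2M;
    by rewrite ?lee_fin ?ltW// ?(ltW ru) ?(ltW sv).
- by rewrite (lt_trans _ ru).
- by rewrite (lt_trans _ sv).
Qed.

End poweR_facts.

(** * The one-dimensional Prekopa-Leindler inequality *)

Section lebesgue_line.
Context {R : realType}.
Local Open Scope ereal_scope.
Local Notation leb := (@lebesgue_measure R).

(** By uniqueness: 1/c times the image of Lebesgue measure under x -> (x - r)/c gives the right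
    value to half-open intervals. *)
Lemma lebesgue_measure_affine (c r : R) (A : set R) : (0 < c)%R ->
  measurable A -> leb [set x | A ((x - r) / c)%R] = c%:E * leb A.
Proof.
move=> c0 mA.
pose phi (x : measurableTypeR R) : measurableTypeR R := ((x - r) / c)%R.
have mphi : measurable_fun setT phi.
  by apply: measurable_funM => //; apply: measurable_funB.
have cinv0 : (0 <= c^-1)%R by rewrite invr_ge0 ltW.
pose m1 : {measure set (measurableTypeR R) -> \bar R} :=
  mscale (NngNum cinv0) (image_measure leb mphi).
have m1E X : m1 X = c^-1%:E * leb (phi @^-1` X) by [].
rewrite (@lebesgue_measure_unique _ m1 _ A mA); last first.
  move=> _ [[u v]] _ <-; rewrite m1E /=.
  rewrite (_ : phi @^-1` _ = `]c * u + r, c * v + r]%classic%R); last first.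
    apply/seteqP; split => x; rewrite /phi /=!in_itv/=.
      by rewrite ltr_pdivlMr// ler_pdivrMr// ltrBrDr lerBlDr ![(_ * c)%R]mulrC.
    by rewrite ltr_pdivlMr// ler_pdivrMr// ltrBrDr lerBlDr ![(_ * c)%R]mulrC.
  rewrite !lebesgue_measure_itv/= !lte_fin ltrD2r ltr_pM2l//.
  case: ifP => _; last by rewrite mule0.

  by rewrite -!EFinD -EFinM; congr EFin; field; rewrite gt_eqF.
by rewrite m1E muleA -EFinM mulfV ?gt_eqF// mul1e.
Qed.

Lemma measure_bigcup_le d (T : measurableType d) (mu : {measure set T ->
  \bar R})
    (F : (set T)^nat) (r : \bar R) :
  (forall n, measurable (F n)) -> nondecreasing_seq F ->
  (forall n, mu (F n) <= r) -> mu (\bigcup_n F n) <= r.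
Proof.
move=> mF ndF Fr.
have mU : measurable (\bigcup_n F n) by exact: bigcupT_measurable.
have cF := nondecreasing_cvg_mu (mu := mu) mF mU ndF.
rewrite -(cvg_lim _ cF)//; apply: lime_le; first by apply/cvg_ex;
  exists (mu (\bigcup_n F n)).
by apply: nearW => n; exact: Fr.
Qed.

(** Continuity from below along levels q_n, each below some point of [A], that increase to sup A or
    to +oo; the only point of [A] that may be missed is sup A, a null set. This stands in for the
    maximum that [A] may fail to attain. *)
Lemma lebesgue_measure_setIlt (A : set R) (r : \bar R) : measurable A ->
  (exists x, A x) -> (forall x, A x -> leb (A `&` `]-oo, x[) <= r) ->
  leb A <= r.
Proof.
move=> mA [x0 Ax0] H.
have mI (u : R) : measurable (A `&` `]-oo, u]) by exact: measurableI.
have key (q : R^nat) (N : set R) : measurable N -> leb N = 0 ->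
    nondecreasing_seq q -> (forall n, exists2 x, A x & (q n < x)%R) ->
    A `<=` \bigcup_n [set` `]-oo, q n]%R] `|` N -> leb A <= r.
  move=> mN N0 ndq qA AN.
  have mU : measurable (\bigcup_n (A `&` `]-oo, q n]))
    by exact: bigcupT_measurable.
  have : leb A <= leb ((\bigcup_n (A `&` `]-oo, q n])) `|` N).
    rewrite le_measure ?inE//; first exact: measurableU.
    move=> x Ax; have [[n _ xn]|Nx] := AN _ Ax; last by right.
    by left; exists n.
  move=> /le_trans; apply; apply: le_trans (measureU2 _ _ _) _ => //.
  rewrite [X in _ + X]N0 adde0; apply: measure_bigcup_le => //.
  - by move=> n; exact: mI.
  - move=> m n mn; apply/subsetPset; apply: setIS => x /=; rewrite !in_itv/=.
    by move=> /le_trans; apply; exact: ndq.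
  - move=> n; have [x Ax qx] := qA n; apply: le_trans (H _ Ax).
    rewrite le_measure ?inE//; [exact: measurableI|exact: measurableI|].
  by apply: setIS => y /=; rewrite !in_itv/= => /le_lt_trans; apply.
have [ubA|nubA] := pselect (has_ubound A); last first.
  apply: (key (fun n => n%:R)%R set0) => //.
  - by move=> m n mn; rewrite ler_nat.
  - move=> n; apply: contrapT => An; apply: nubA; exists n%:R%R => x Ax.
    by rewrite leNgt; apply/negP => nx; apply: An; exists x.
  - move=> x _; left; exists (Num.truncn `|x|).+1 => //=; rewrite in_itv/=.
    by rewrite (le_trans (ler_norm _))// ltW// truncnS_gt.
have supA : has_sup A by split => //; exists x0.
apply: (key (fun n => sup A - n.+1%:R^-1)%R [set sup A]) => //.
- by rewrite lebesgue_measure_set1.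
- by move=> m n mn; rewrite lerD2l lerN2 lef_pV2 ?posrE// ler_nat.
- by move=> n; have [|x Ax] := @sup_adherent _ A n.+1%:R^-1%R _ supA;
  [rewrite invr_gt0|exists x].
- move=> x Ax; have : (x <= sup A)%R by apply: ub_le_sup.
  rewrite le_eqVlt => /predU1P[->|xA]; [by right|left].
  exists (Num.truncn (sup A - x)^-1) => //=; rewrite in_itv/=.
  rewrite lerBrDr -lerBrDl -[leRHS]invrK lef_pV2 ?posrE ?invr_gt0 ?subr_gt0//.
  by rewrite ltW// truncnS_gt.
Qed.

Lemma lebesgue_measure_shift (r : R) (A : set R) : measurable A ->
  leb [set x | A (x - r)%R] = leb A.
Proof.
move=> mA; rewrite -[RHS]mul1e -(@lebesgue_measure_affine 1 r A)//.
by congr (leb _); apply/seteqP; split => x /=; rewrite divr1.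
Qed.

Lemma measurable_shift (r : R) (A : set R) : measurable A ->
  measurable [set x | A (x - r)%R].
Proof.
move=> mA; rewrite [X in measurable X](_ : _ = (fun x => x - r)%R @^-1` A)//.
by rewrite -[X in measurable X]setTI; apply: measurable_funB.
Qed.

Lemma lebesgue_measure_setIgt (A : set R) (r : \bar R) : measurable A ->
  (exists x, A x) -> (forall x, A x -> leb (A `&` `]x, +oo[) <= r) ->
  leb A <= r.
Proof.
move=> mA [x0 Ax0] H.
have mN (B : set R) : measurable B -> measurable [set x | B (- x)%R].
  move=> mB; rewrite [X in measurable X](_ : _ = (fun x => - x)%R @^-1` B)//.
  by rewrite -[X in measurable X]setTI; apply: measurable_funN.
rewrite -lebesgue_measureN//; apply: lebesgue_measure_setIlt.
- exact: mN.
- by exists (- x0)%R; rewrite /= opprK.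
- move=> x Ax; apply: le_trans (H _ Ax).
  rewrite -[leRHS]lebesgue_measureN//; last exact: measurableI.
  rewrite /pushforward le_measure ?inE//.
  + by apply: measurableI => //; exact: mN.
  + by apply: (mN (A `&` `](- x)%R, +oo[)); exact: measurableI.
  + by move=> y [Ay]; rewrite /= !in_itv/= andbT ltrN2.
Qed.

(* For x in A and y in B, the sets (A `&` ]-oo, x[) + y and
   x + (B `&` ]y, +oo[) are disjoint subsets of C. *)
Lemma brunn_minkowski_line (A B C : set R) :
  measurable A -> measurable B -> measurable C ->
  (exists x, A x) -> (exists x, B x) ->
  (forall x y, A x -> B y -> C (x + y)%R) ->
  leb A + leb B <= leb C.
Proof.
move=> mA mB mC A0 B0 ABC.
have key x y : A x -> B y ->
    leb (A `&` `]-oo, x[) + leb (B `&` `]y, +oo[) <= leb C.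
  move=> Ax By.
  have mA' : measurable (A `&` `]-oo, x[) by exact: measurableI.
  have mB' : measurable (B `&` `]y, +oo[) by exact: measurableI.
  rewrite -(lebesgue_measure_shift y mA') -(lebesgue_measure_shift x mB').
  have m1 := measurable_shift y mA'; have m2 := measurable_shift x mB'.
  rewrite -measureU//; last first.
    rewrite -subset0 => z [] /= [_ +] [_]; rewrite !in_itv/= andbT => zx yz.
    by lra.
  rewrite le_measure ?inE//; first exact: measurableU.
  by move=> z [[Az _]|[Bz _]]; [have := ABC _ _ Az By|have := ABC _ _ Ax Bz];
    rewrite ?subrK// addrC subrK.
have [->|Coo] := eqVneq (leb C) +oo; first by rewrite leey.
have {}Coo : leb C \is a fin_num by rewrite fin_numE Coo andbT gt_eqF//
  (lt_le_trans _ (measure_ge0 _ _)).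
have finl (u v : \bar R) : 0 <= u -> 0 <= v -> u + v <= leb C ->
  u \is a fin_num.
  move=> u0 v0 uvC; rewrite ge0_fin_numE// (le_lt_trans _ (_ : leb C < +oo))//.
    by apply: le_trans uvC; rewrite leeDl.
  by rewrite ltey_eq Coo.
(* With leb C finite, one term can be subtracted while the other is exhausted: first x runs through
   A, then y through B. *)
have key2 y : B y -> leb A + leb (B `&` `]y, +oo[) <= leb C.
  move=> By; case: (A0) => x Ax.
  have fB : leb (B `&` `]y, +oo[) \is a fin_num.
    by apply: (finl _ (leb (A `&` `]-oo, x[))) => //; rewrite addeC; exact: key.
  rewrite -leeBrDr//; apply: lebesgue_measure_setIlt => // x' Ax'.
  by rewrite leeBrDr//; exact: key.
have [y By] := B0.
have fA : leb A \is a fin_num.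
  by apply: (finl _ (leb (B `&` `]y, +oo[))) => //; exact: key2.
rewrite addeC -leeBrDr//; apply: lebesgue_measure_setIgt => // y' By'.
by rewrite leeBrDr// addeC; exact: key2.
Qed.

End lebesgue_line.

Section prekopa_leindler.
Context {R : realType}.
Variables a b : R.
Local Open Scope ereal_scope.

(* T x y z reads: z is a mean of x and y.  A relation rather than a function,
   so that the means of Lebesgue measures on lines tensorize, and so that the
   geometric mean can ignore signs. *)
Definition prekopa_leindler d (X : measurableType d)
    (mu : {measure set X -> \bar R}) (T : X -> X -> X -> Prop) :=
  forall f g h : X -> \bar R,
    measurable_fun setT f -> measurable_fun setT g -> measurable_fun setT h ->
    (forall x, 0 <= f x) -> (forall x, 0 <= g x) -> (forall x, 0 <= h x) ->
    (forall x y z, T x y z -> f x `^ a * g y `^ b <= h z) ->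
    (\int[mu]_x f x) `^ a * (\int[mu]_x g x) `^ b <= \int[mu]_x h x.

Hypotheses (a0 : (0 < a)%R) (b0 : (0 < b)%R) (ab1 : (a + b = 1)%R).

Import HBNNSimple.

(* Simple functions below f and g stand for these possibly non-measurable
   functions. *)
Lemma prekopa_leindler_inner d (X : measurableType d)
    (mu : {measure set X -> \bar R}) (T : X -> X -> X -> Prop) :
  prekopa_leindler mu T ->
  forall f g h : X -> \bar R, measurable_fun setT h ->
    (forall x, 0 <= f x) -> (forall x, 0 <= g x) -> (forall x, 0 <= h x) ->
    (forall x y z, T x y z -> f x `^ a * g y `^ b <= h z) ->
    (\int[mu]_x f x) `^ a * (\int[mu]_x g x) `^ b <= \int[mu]_x h x.
Proof.
move=> PL f g h mh f0 g0 h0 fgh; apply: poweR_integral_nnsfun => //.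
  exact: integral_ge0.
move=> u v uf vg _ _; apply: PL => //.
- exact/measurable_EFinP.
- exact/measurable_EFinP.
- by move=> x; rewrite lee_fin.
- by move=> x; rewrite lee_fin.
- move=> x y z xyz; apply: le_trans (fgh _ _ _ xyz).
  by apply: lee_poweR2M; rewrite // lee_fin.
Qed.

Local Notation leb := (@lebesgue_measure R).

(** When both suprema are 1, the levels {u > t} and {v > t} are nonempty for the same t, namely 0 <
    t < 1, so the Brunn-Minkowski inequality applies to a {u > t} + b {v > t}, a subset of {h > t}.
    Integration in t gives an arithmetic mean of the integrals, stronger than the geometric one. *)
Let PL_line_normalized (u v : measurableTypeR R -> R)
    (h : measurableTypeR R -> \bar R) :
  measurable_fun setT u -> measurable_fun setT v -> measurable_fun setT h ->
  (forall x, 0 <= u x <= 1)%R -> (forall x, 0 <= v x <= 1)%R ->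
  (forall x, 0 <= h x) ->
  (forall t, t < 1 -> exists x, t < u x)%R ->
  (forall t, t < 1 -> exists x, t < v x)%R ->
  (forall x y, (u x `^ a * v y `^ b)%:E <= h (a * x + b * y)%R) ->
  a%:E * \int[leb]_x (u x)%:E + b%:E * \int[leb]_x (v x)%:E <=
  \int[leb]_x h x.
Proof.
move=> mu_ mv mh u01 v01 h0 supu supv uvh.
have mEu : measurable_fun setT (EFin \o u) by exact/measurable_EFinP.
have mEv : measurable_fun setT (EFin \o v) by exact/measurable_EFinP.
have layer (w : measurableTypeR R -> \bar R) : measurable_fun setT w ->
  (forall x, 0 <= w x) ->
    \int[leb]_x w x = \int[leb]_t leb [set x | (0 < t)%R /\ t%:E < w x] /\
    measurable_fun setT (fun t : measurableTypeR R => leb [set x | (0 < t)%R /\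
      t%:E < w x]).
  move=> mw w0.
  have E t : \int[leb]_(x in [set x | (0 < t)%R /\ t%:E < w x]) 1 =
      leb [set x | (0 < t)%R /\ t%:E < w x].
    by rewrite integral_cst ?mul1e//; exact: measurable_superlevel.
  split.
    under [RHS]eq_integral do rewrite -E.
    rewrite -(layer_cake leb mw (measurable_cst 1))//.
    by apply: eq_integral => x _; rewrite mul1e.
  under eq_fun do rewrite -E.
  exact: (measurable_layer leb mw (measurable_cst 1)).
have u0 x : 0 <= (EFin \o u) x by rewrite lee_fin; case/andP: (u01 x).
have v0 x : 0 <= (EFin \o v) x by rewrite lee_fin; case/andP: (v01 x).
have [-> mlu] := layer _ mEu u0; have [-> mlv] := layer _ mEv v0.
have [-> mlh] := layer _ mh h0.
rewrite -!ge0_integralZl//; try by rewrite lee_fin ltW.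
rewrite -ge0_integralD//; last 4 first.
- by move=> t _; rewrite mule_ge0// lee_fin ltW.
- exact: measurable_funeM.
- by move=> t _; rewrite mule_ge0// lee_fin ltW.
- exact: measurable_funeM.
apply: ge0_le_integralT => t.
  by rewrite adde_ge0// mule_ge0// lee_fin ltW.
have [t0|] := boolP (t <= 0)%R.
  have E (w : R -> \bar R) : [set x | (0 < t)%R /\ t%:E < w x] = set0.
    by rewrite -subset0 => x [/=]; rewrite ltNge t0.
  by rewrite !E !measure0 !mule0 adde0.
rewrite -ltNge => t0; have [t1|] := boolP (1 <= t)%R.
  have E (w : R -> R) : (forall x, 0 <= w x <= 1)%R ->
      [set x | (0 < t)%R /\ t%:E < (EFin \o w) x] = set0.
    move=> w01; rewrite -subset0 => x [/= _]; rewrite lte_fin => tw.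
    by have /andP[_] := w01 x; rewrite leNgt (le_lt_trans t1 tw).
  by rewrite !E// !measure0 !mule0 adde0.
rewrite -ltNge => t1; have mU := measurable_superlevel mEu t.
have mV := measurable_superlevel mEv t.
have E (c : R) (w : measurableTypeR R -> \bar R) : (0 < c)%R ->
  measurable_fun setT w ->
    measurable [set x | (0 < t)%R /\ t%:E < w (x / c)%R] /\
    c%:E * leb [set x | (0 < t)%R /\ t%:E < w x] =
    leb [set x | (0 < t)%R /\ t%:E < w (x / c)%R].
  move=> c0 mw; have mS := measurable_superlevel mw t; split.
    rewrite [X in measurable X](_ : _ = (fun x => x / c)%R @^-1`
      [set x | (0 < t)%R /\ t%:E < w x])//.
    by rewrite -[X in measurable X]setTI; apply: measurable_funM.
  rewrite -(lebesgue_measure_affine 0 c0)//.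
  by congr (leb _); apply/seteqP; split => x /=; rewrite subr0.
have [mU' ->] := E _ _ a0 mEu; have [mV' ->] := E _ _ b0 mEv.
apply: brunn_minkowski_line => //.
- exact: measurable_superlevel.
- have [x xt] := supu _ t1; exists (a * x)%R => /=.
  by rewrite [(a * x)%R]mulrC mulfK ?gt_eqF// lte_fin.
- have [x xt] := supv _ t1; exists (b * x)%R => /=.
  by rewrite [(b * x)%R]mulrC mulfK ?gt_eqF// lte_fin.
- move=> x y [_ /= tx] [_ /= ty]; split => //.
  have := uvh (x / a)%R (y / b)%R.
  rewrite ![(_ * (_ / _))%R]mulrC !divfK ?gt_eqF//; apply: lt_le_trans.
  rewrite lte_fin -[ltLHS](powRr1 (ltW t0)) -ab1 powRD; last first.
    by rewrite ab1 oner_eq0.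
  rewrite !lte_fin in tx ty.
  by rewrite ltr_pM ?powR_ge0// gt0_ltr_powR// ?nnegrE ?ltW// (lt_trans t0).
Qed.

(** Dividing [u] by its supremum A, [v] by its supremum B and [h] by A^a B^b changes both sides by
    the same factor, which reduces to the normalized case; the inequality of arithmetic and
    geometric means then finishes. *)
Lemma prekopa_leindler_line :
  prekopa_leindler leb (fun x y z => z = a * x + b * y)%R.
Proof.
move=> f g h mf mg mh f0 g0 h0 fgh.
apply: poweR_integral_nnsfun => //; first exact: integral_ge0.
move=> u v uf vg.
have sup_gt0 (w : {nnsfun (measurableTypeR R) >-> R}) :
  0 < \int[leb]_x (w x)%:E ->
    [/\ (0 < sup (range w))%R, (forall x, 0 <= w x / sup (range w) <= 1)%R &
     (forall t, t < 1 -> exists x, t < w x / sup (range w))%R].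
  move=> w0.
  have supw : has_sup (range w).
    split; first by exists (w 0%R), 0%R.
    have [M [_ /(_ (M + 1)%R)]] := simple_bounded w.
    rewrite ltrDl ltr01 => /(_ isT) wM; exists (M + 1)%R => _ [x _ <-].
    exact: le_trans (ler_norm _) (wM x I).
  have s0 : (0 < sup (range w))%R.
    rewrite ltNge; apply/negP => s0; move: w0;
      rewrite integral0_eq ?ltxx// => x _.
    congr EFin; apply/eqP; rewrite eq_le fun_ge0 andbT (le_trans _ s0)//.
    by apply: ub_le_sup; [case: supw|exists x].
  split => //.
    move=> x; apply/andP; split; first by rewrite divr_ge0// ltW.
    rewrite ler_pdivrMr// mul1r.
    by apply: ub_le_sup; [case: supw|exists x].
  move=> t t1; have e0 : (0 < (1 - t) * sup (range w))%R by rewrite mulr_gt0//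
    subr_gt0.
  have [_ [x _ <-] xw] := sup_adherent e0 supw; exists x.
  rewrite ltr_pdivlMr//; apply: le_lt_trans xw.
  by rewrite mulrBl mul1r opprB addrC subrK.
move=> /sup_gt0[A0 uA01 uAt] /sup_gt0[B0 vB01 vBt].
set A := sup (range u) in A0 uA01 uAt; set B := sup (range v) in B0 vB01 vBt.
have C0 : (0 < A `^ a * B `^ b)%R by rewrite mulr_gt0 ?powR_gt0.
set C := (A `^ a * B `^ b)%R in C0.
have scale (w : {nnsfun (measurableTypeR R) >-> R}) (c : R) : (0 < c)%R ->
   \int[leb]_x (w x)%:E = c%:E * \int[leb]_x (w x / c)%:E.
  move=> c0; rewrite -ge0_integralZl//.
  - by apply: eq_integral => x _; rewrite -EFinM mulrC divfK ?gt_eqF.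
  - by apply/measurable_EFinP; apply: measurable_funM.
  - by move=> x _; rewrite lee_fin divr_ge0// ltW.
  - by rewrite lee_fin ltW.
rewrite (scale u A)// (scale v B)// !poweRM; try by rewrite lee_fin ltW.
  2: by apply: integral_ge0 => x _; rewrite lee_fin; case/andP: (vB01 x).
  2: by apply: integral_ge0 => x _; rewrite lee_fin; case/andP: (uA01 x).
rewrite muleACA -EFinM -/C -lee_pdivlMl//.
rewrite -ge0_integralZl//; last by rewrite lee_fin invr_ge0 ltW.
apply: le_trans (poweR_AM_GM a0 b0 ab1 _ _) _.
- by apply: integral_ge0 => x _; rewrite lee_fin; case/andP: (uA01 x).
- by apply: integral_ge0 => x _; rewrite lee_fin; case/andP: (vB01 x).
apply: PL_line_normalized => //.
- by apply: measurable_funM.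
- by apply: measurable_funM.
- exact: measurable_funeM.
- by move=> x; rewrite mule_ge0// lee_fin invr_ge0 ltW.
move=> x y; rewrite lee_pdivlMl// -EFinM; apply: le_trans (fgh x y _ erefl).
have /andP[uA _] := uA01 x; have /andP[vB _] := vB01 y.
rewrite /C mulrACA -(powRM _ (ltW A0) uA) -(powRM _ (ltW B0) vB).
rewrite ![(_ * (_ / _))%R]mulrC !divfK ?gt_eqF// EFinM -!poweR_EFin.
by apply: lee_poweR2M; rewrite // lee_fin.
Qed.

End prekopa_leindler.

(* The substitution is x = exp(-t), not exp(t): the improper integrals are then
   over intervals [a, +oo[. *)
Section exp_substitution.
Context {R : realType}.
Local Open Scope ereal_scope.
Local Notation leb := (@lebesgue_measure R).

Let phi (t : measurableTypeR R) : measurableTypeR R := expR (- t).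

Let measurable_phi : measurable_fun setT phi.
Proof. by apply: measurableT_comp => //; exact: measurable_funN. Qed.

Let w (t : measurableTypeR R) : \bar R := (phi t)%:E.

Let measurable_w : measurable_fun setT w.
Proof. exact/measurable_EFinP. Qed.

Let w0 t : 0 <= w t. Proof. by rewrite lee_fin expR_ge0. Qed.

Let mu (A : set (measurableTypeR R)) := \int[leb]_(t in A) w t.

Let mu0 : mu set0 = 0. Proof. exact: integral_set0. Qed.

Let mu_ge0 A : 0 <= mu A. Proof. exact: integral_ge0. Qed.

Let mu_sigma_additive : semi_sigma_additive mu.
Proof. exact: semi_sigma_additive_nng_induced. Qed.

HB.instance Definition _ := isMeasure.Build _ _ _ mu mu0 mu_ge0
  mu_sigma_additive.

Let nu := image_measure mu measurable_phi.

Let nuE A : nu A = \int[leb]_(t in phi @^-1` A) w t. Proof. by []. Qed.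

Let mNy0 : measurable (`]-oo, 0%R] : set (measurableTypeR R)).
Proof. exact: measurable_itv. Qed.

Let nu_itvoc (v : R) : (0 < v)%R -> nu `]0%R, v]%classic = v%:E.
Proof.
move=> v0; rewrite nuE.
have -> : phi @^-1` `]0%R, v]%classic = `[(- ln v)%R, +oo[%classic.
  apply/seteqP; split => t; rewrite /phi /= !in_itv/= andbT expR_gt0/=.
    by move=> tv; rewrite lerNl -ler_expR lnK.
  by rewrite lerNl => tv; rewrite -(@lnK _ v)// ler_expR.
rewrite (@ge0_continuous_FTC2y _ _ (fun t => - expR (- t))%R _ 0%R).
- by rewrite opprK lnK// sub0e EFinN oppeK.
- by move=> x _; exact: expR_ge0.
- apply: continuous_subspaceT => x; apply: continuous_comp.
    exact: opp_continuous.
  exact: continuous_expR.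
- rewrite -oppr0; apply: cvgN; apply: cvgr_expR.
- by move=> x _.
- apply: cvg_at_right_filter; apply: cvgN; apply: continuous_comp.
    exact: opp_continuous.
  exact: continuous_expR.
- move=> x _; rewrite derive1E.
  by rewrite derive_val mulrN1 opprK.
Qed.

(** [nu] is Lebesgue measure on the positive half-line, written as the image of e^(-t) dt under t ->
    e^(-t). By uniqueness of Lebesgue measure only intervals ]u, v] matter, and these reduce to
    [nu_itvoc], an integral of e^(-t) over [- ln v, +oo[. *)
Let lebesgue_nu A : measurable A -> leb A = leb (A `&` `]-oo, 0%R]) + nu A.
Proof.
move=> mA; pose m1 : {measure set (measurableTypeR R) -> \bar R} :=
  mrestr leb mNy0.
pose m : {measure set (measurableTypeR R) -> \bar R} := measure_add m1 nu.
have mE (B : set (measurableTypeR R)) : m B = leb (B `&` `]-oo, 0%R]) + nu B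
  by have := measure_addE m1 nu B.
suff key (u v : R) : leb `]u, v]%classic =
    leb (`]u, v]%classic `&` `]-oo, 0%R]) + nu `]u, v]%classic.
  rewrite -mE; apply: (@lebesgue_measure_unique _ m) => // _ [[u v]] _ <-.
  by rewrite mE; exact: key.
have phi_gt0 t : (0 < phi t)%R by exact: expR_gt0.
have [v0|] := leP v 0%R.
  rewrite (_ : _ `&` _ = `]u, v]%classic); last first.
    apply/seteqP; split => x /=; rewrite !in_itv/=; first by case.
    by move=> /andP[-> xv]; rewrite xv (le_trans xv).
  rewrite nuE (_ : _ @^-1` _ = set0) ?integral_set0 ?adde0//.
  rewrite -subset0 => t /=; rewrite in_itv/= => /andP[_].
  by rewrite leNgt (le_lt_trans v0).
move=> v0; have [u0|u0] := leP u 0%R.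
  rewrite (_ : _ `&` _ = `]u, 0%R]%classic); last first.
    apply/seteqP; split => x /=; rewrite !in_itv/=.
      by move=> [/andP[-> _] ->].
    by move=> /andP[-> x0]; rewrite x0 (le_trans x0)// ltW.
  have -> : nu `]u, v]%classic = nu `]0%R, v]%classic.
    rewrite !nuE; congr (integral _ _ _); apply/seteqP; split => t /=;
      rewrite !in_itv/=.
      by move=> /andP[_ ->]; rewrite phi_gt0.
    by move=> /andP[_ ->]; rewrite (le_lt_trans u0).
  rewrite nu_itvoc// !lebesgue_measure_itv/= !lte_fin (le_lt_trans u0 v0).
  case: ltP => [_|u0']; first by rewrite -!EFinD add0r addrC.
  by rewrite add0e (@le_anti _ _ u 0%R) ?u0// oppr0 adde0.
rewrite (_ : _ `&` _ = set0); last first.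
  rewrite -subset0 => x [] /=; rewrite !in_itv/= => /andP[ux _].
  by rewrite leNgt (lt_trans u0).
rewrite measure0 add0e.
have [uv|vu] := ltP u v; last first.
  by rewrite set_itv_ge ?measure0// bnd_simp -leNgt.
have -> : `]u, v]%classic = `]0%R, v]%classic `\` `]0%R, u]%classic :> set R.
  apply/seteqP; split => x /=; rewrite !in_itv/=.
    by move=> /andP[ux ->]; rewrite (lt_trans u0 ux)/= (lt_geF ux).
  by move=> [/andP[-> ->]]/= /negP; rewrite -ltNge => ->.
rewrite !measureD//=; last 2 first.
- by rewrite nu_itvoc// ltry.
- by rewrite lebesgue_measure_itv/= lte_fin v0 -EFinB ltry.
rewrite (_ : _ `&` _ = `]0%R, u]%classic); last first.
  apply/seteqP; split => x /=; rewrite !in_itv/=; first by case.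
  by move=> /andP[-> xu]; rewrite xu (le_trans xu)// ltW.
by rewrite !nu_itvoc// !lebesgue_measure_itv/= !lte_fin v0 u0 !sube0.
Qed.

Lemma lebesgue_measure_expN (A : set (measurableTypeR R)) : measurable A ->
  \int[leb]_(t in (fun t => expR (- t)) @^-1` A) (expR (- t))%:E =
  leb (A `&` `]0%R, +oo[).
Proof.
move=> mA; rewrite lebesgue_nu; last exact: measurableI.
rewrite -setIA (_ : _ `&` `]-oo, _] = set0); last first.
  by rewrite -subset0 => x [] /=; rewrite !in_itv/= andbT leNgt => ->.
rewrite setI0 measure0 add0e nuE; congr (integral _ _ _).
by apply/seteqP; split => t /=; rewrite in_itv/= expR_gt0; [|case].
Qed.

(** The layer cake formula on both sides reduces the substitution to level sets, with the indicator
    of the half-line as weight on the left and e^(-t) on the right. *)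
Lemma ge0_integral_expN (f : measurableTypeR R -> \bar R) :
  measurable_fun setT f -> (forall x, 0 <= f x) ->
  \int[leb]_(x in `]0%R, +oo[) f x =
  \int[leb]_t ((expR (- t))%:E * f (expR (- t))).
Proof.
move=> mf f0.
rewrite integral_mkcond.
have mI : measurable (`]0%R, +oo[ : set (measurableTypeR R))
  by exact: measurable_itv.
transitivity (\int[leb]_x ((\1_(`]0%R, +oo[ : set R) x)%:E * f x)).
  apply: eq_integral => x _; rewrite patchE indicE.
  by case: ifP; rewrite ?mul1e ?mul0e.
rewrite (layer_cake leb mf)//; last first.
  by apply/measurable_EFinP; exact: measurable_indic.
have mfphi : measurable_fun setT (f \o phi) by exact: measurableT_comp.
rewrite [RHS](layer_cake leb mfphi measurable_w)//; last by move=> x; exact: f0.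
apply: eq_integral => t _; rewrite integral_indic//;
  last exact: measurable_superlevel.
by rewrite setIC; apply/esym/lebesgue_measure_expN;
  exact: measurable_superlevel.
Qed.

End exp_substitution.

(** * The Prekopa-Leindler inequality for geometric means *)

Section multiplicative_line.
Context {R : realType}.
Local Open Scope ereal_scope.
Local Notation leb := (@lebesgue_measure R).

Lemma ge0_integral_line_expN (f : measurableTypeR R -> \bar R) :
  measurable_fun setT f -> (forall x, 0 <= f x) ->
  \int[leb]_x f x = \int[leb]_t ((expR (- t))%:E * f (expR (- t))) +
                    \int[leb]_t ((expR (- t))%:E * f (- expR (- t))%R).
Proof.
move=> mf f0.
have mfN : measurable_fun setT (fun x : measurableTypeR R => f (- x)%R).
  by apply: measurableT_comp => //; exact: measurable_funN.
have mI : measurable (`]0%R, +oo[ : set (measurableTypeR R))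
  by exact: measurable_itv.
rewrite -(ge0_integral_expN mf f0) -(ge0_integral_expN mfN (fun x => f0 _)).
rewrite -{1}(setUv `]0%R, +oo[) ge0_integral_setU//; last 3 first.
- exact: measurableC.
- exact: measurable_funTS.
- by rewrite disj_set2E setICr.
congr (_ + _).
rewrite (_ : ~` _ = `]-oo, 0%R]%classic); last first.
  apply/seteqP; split => x /=; rewrite !in_itv/= andbT.
    by move=> /negP; rewrite -leNgt.
  by move=> x0; apply/negP; rewrite -leNgt.
rewrite integral_itv_obnd_cbnd; last exact: measurable_funTS.
rewrite ge0_integration_by_substitution0//.
by apply: eq_integral => x _; rewrite opprK.
Qed.

Variables a b : R.
Hypotheses (a0 : (0 < a)%R) (b0 : (0 < b)%R) (ab1 : (a + b = 1)%R).

(** Each sum is at most twice its larger term, and (2 x)^a (2 y)^b = 2 x^a y^b; one copy of x^a y^b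
    is bounded by [z1], the other by [z2]. *)
Lemma poweR2M_add_le (x1 x2 y1 y2 z1 z2 : \bar R) :
  0 <= x1 -> 0 <= x2 -> 0 <= y1 -> 0 <= y2 ->
  (forall x y z, x \in [:: x1; x2] -> y \in [:: y1; y2] -> z \in [:: z1; z2] ->
    x `^ a * y `^ b <= z) ->
  (x1 + x2) `^ a * (y1 + y2) `^ b <= z1 + z2.
Proof.
move=> x10 x20 y10 y20 H.
have double (u1 u2 : \bar R) : 0 <= u1 -> 0 <= u2 -> exists u,
    [/\ u \in [:: u1; u2], 0 <= u & u1 + u2 <= 2%:E * u].
  move=> u10 u20; have [u12|u21] := leP u1 u2.
    exists u2; rewrite !inE eqxx orbT; split=> //.
    by rewrite (_ : 2%:E = 1 + 1) ?EFinD// ge0_muleDl// mul1e leeD2r.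
  exists u1; rewrite !inE eqxx; split=> //.
  by rewrite (_ : 2%:E = 1 + 1) ?EFinD// ge0_muleDl// mul1e leeD2l// ltW.
have [x [xin x0 xle]] := double _ _ x10 x20.
have [y [yin y0 yle]] := double _ _ y10 y20.
apply: (@le_trans _ _ ((2%:E * x) `^ a * (2%:E * y) `^ b)).
  by apply: lee_poweR2M => //; exact: adde_ge0.
rewrite !poweRM ?lee_fin// muleACA -EFinM -powRD; last first.
  by rewrite ab1 oner_eq0.
rewrite ab1 powRr1// (_ : 2%:E = 1 + 1) ?EFinD// ge0_muleDl ?mul1e//.
by apply: leeD; apply: H; rewrite // !inE eqxx ?orbT.
Qed.

(** On a half-line, x = s e^(-t) with s = 1 or -1 turns geometric means into arithmetic means of t,
    and the Jacobian e^(-t) is itself log-affine, so the additive inequality applies. Since the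
    relation ignores signs, every choice of half-lines for [f], [g] and [h] is allowed, and
    [poweR2M_add_le] puts the halves together. *)
Lemma prekopa_leindler_line_geometric :
  prekopa_leindler a b leb (fun x y z =>
    [/\ x != 0%R, y != 0%R & (`|z| = `|x| `^ a * `|y| `^ b)%R]).
Proof.
move=> f g h mf mg mh f0 g0 h0 fgh.
rewrite (ge0_integral_line_expN mf f0) (ge0_integral_line_expN mg g0).
rewrite (ge0_integral_line_expN mh h0).
pose E (k : measurableTypeR R -> \bar R) (s : R) (t : measurableTypeR R) :=
  (expR (- t))%:E * k (s * expR (- t))%R.
have E0 k s t : (forall x, 0 <= k x) -> 0 <= E k s t.
  by move=> k0; rewrite mule_ge0// lee_fin expR_ge0.
have mE k s : measurable_fun setT k -> measurable_fun setT (E k s).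
  move=> mk; have mexp : measurable_fun setT (fun t : measurableTypeR R => expR
    (- t)).
    by apply: measurableT_comp => //; exact: measurable_funN.
  apply: emeasurable_funM; first exact/measurable_EFinP.
  by apply: measurableT_comp => //; exact: measurable_funM.
have E1 k : \int[leb]_t ((expR (- t))%:E * k (expR (- t))) =
  \int[leb]_t E k 1%R t.
  by apply: eq_integral => t _; rewrite /E mul1r.
have EN1 k : \int[leb]_t ((expR (- t))%:E * k (- expR (- t))%R) =
    \int[leb]_t E k (-1)%R t.
  by apply: eq_integral => t _; rewrite /E mulN1r.
rewrite !E1 !EN1.
have key (s1 s2 s3 : R) : (`|s1| = 1)%R -> (`|s2| = 1)%R -> (`|s3| = 1)%R ->
    (\int[leb]_t E f s1 t) `^ a * (\int[leb]_t E g s2 t) `^ b <=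
    \int[leb]_t E h s3 t.
  move=> s11 s21 s31.
  apply: (prekopa_leindler_line a0 b0 ab1); try exact: mE; try by move=> t;
    exact: E0.
  move=> x y z ->; rewrite /E !poweRM ?lee_fin ?expR_ge0// muleACA.
  rewrite poweR_EFin poweR_EFin -EFinM -!expRM -expRD.
  have -> : (- x * a + - y * b = - (a * x + b * y))%R by ring.
  rewrite lee_pmul2l ?lte_fin ?expR_gt0//; apply: fgh; split.
  - by rewrite -normr_eq0 normrM s11 mul1r normr_eq0 gt_eqF ?expR_gt0.
  - by rewrite -normr_eq0 normrM s21 mul1r normr_eq0 gt_eqF ?expR_gt0.
  rewrite !normrM s11 s21 s31 !mul1r !gtr0_norm ?expR_gt0//.
  by rewrite -!expRM -expRD; congr expR; ring.
apply: poweR2M_add_le; try by apply: integral_ge0 => t _; exact: E0.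
move=> x y z; rewrite !inE => /orP[]/eqP-> /orP[]/eqP-> /orP[]/eqP->;
  by apply: key; rewrite ?normrN normr1.
Qed.

End multiplicative_line.

(** * Lebesgue measure and the Prekopa-Leindler inequality on R^n *)

Section lebesgue_rV_facts.
Context {R : realType}.
Local Open Scope ereal_scope.
Local Notation leb := (@lebesgue_measure R).
Local Notation leb_rV := (@lebesgue_rV R).

(** Boxes are stable under intersection and generate the sigma-algebra, and the cubes [-k, k]^n have
    finite measure and cover the space. *)
Lemma lebesgue_rV_unique n (m : {measure set 'rV[R]_n -> \bar R}) :
  (forall A : 'I_n -> set R, (forall i, measurable (A i)) ->
    m [set x | forall i, A i (x 0%R i)] = \prod_(i < n) leb (A i)) ->
  forall B, measurable B -> leb_rV n B = m B.
Proof.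
move=> mbox.
pose G := [set B | exists2 A : 'I_n -> set R, (forall i, measurable (A i)) &
  B = [set x : 'rV[R]_n | forall i, A i (x 0%R i)]].
pose g k := [set x : 'rV[R]_n | forall i, `[- k%:R, k%:R]%classic%R (x 0%R i)].
apply: (measure_unique G g) => //.
- apply/seteqP; split; last first.
    apply: smallest_sub; first exact: sigma_algebra_measurable.
    by move=> _ [A mA ->]; exact: measurable_rV_box.
  apply: (smallest_sub (smallest_sigma_algebra setT G)).
  rewrite -bigcup_seq => B [i _ [C mC <-]].
  apply: sub_sigma_algebra.
  exists (fun j => if j == i then C else setT); first by move=> j; case: ifP.
  rewrite setTI; apply/seteqP; split => x /=.
    by move=> Cx j; case: eqP => // ->.
  by move=> /(_ i); rewrite eqxx.
- move=> _ _ [A mA ->] [B mB ->]; exists (fun i => A i `&` B i).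
    by move=> i; exact: measurableI.
  apply/seteqP; split => x /=; first by move=> [Ax Bx] i; split.
  by move=> H; split => i; case: (H i).
- by move=> k; exists (fun=> `[- k%:R, k%:R]%classic%R).
- rewrite -subTset => x _.
  exists (Num.truncn (\sum_i `|x 0%R i|)).+1 => // i;
    rewrite /= in_itv/= -ler_norml.
  apply: (@le_trans _ _ (\sum_i `|x 0%R i|)%R);
    last by rewrite ltW// truncnS_gt.
  by rewrite (bigD1 i)//= lerDl sumr_ge0.
- by move=> _ [A mA ->]; rewrite mbox//; exact: lebesgue_rV_box.
- move=> k; rewrite [X in X < _](_ : _ = \prod_(i < n) (k%:R + k%:R)%:E);
  last first.
    rewrite [LHS](lebesgue_rV_box (fun=> measurable_itv _)).
    apply: eq_bigr => i _; rewrite lebesgue_measure_itv/= lte_fin.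
    case: ltP => [_|]; first by rewrite -EFinB opprK.
    by move=> kk; congr EFin; have := ler0n R k; lra.
  by rewrite prodEFin ltry.
Qed.

Lemma ge0_integral_lebesgue_rV_unique d (T : measurableType d) n
    (mu : {measure set T -> \bar R}) (phi : T -> 'rV[R]_n) :
  measurable_fun setT phi ->
  (forall A : 'I_n -> set R, (forall i, measurable (A i)) ->
    mu (phi @^-1` [set x | forall i, A i (x 0%R i)]) =
      \prod_(i < n) leb (A i)) ->
  forall f : 'rV[R]_n -> \bar R, measurable_fun setT f -> (forall x, 0 <=
    f x) ->
  \int[leb_rV n]_x f x = \int[mu]_t f (phi t).
Proof.
move=> mphi H f mf f0.
rewrite -[RHS](ge0_integral_pushforward mphi _ measurableT mf)//.
apply: eq_measure_integral => A mA _.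
by apply: (lebesgue_rV_unique (m := image_measure mu mphi)).
Qed.

(** [rV_cons] with a free position, so that Fubini can single out any coordinate and not only the
    first. *)
Definition rV_ins n (i : 'I_n.+1) (z : measurableTypeR R * 'rV[R]_n) :
  'rV[R]_n.+1 :=
  \row_j (if unlift i j is Some k then z.2 0%R k else z.1).

Lemma rV_insi n (i : 'I_n.+1) z : rV_ins i z 0%R i = z.1.
Proof. by rewrite mxE unlift_none. Qed.

Lemma rV_ins_lift n (i : 'I_n.+1) z k : rV_ins i z 0%R (lift i k) = z.2 0%R k.
Proof. by rewrite mxE liftK. Qed.

Lemma measurable_rV_ins n (i : 'I_n.+1) : measurable_fun setT (rV_ins i).
Proof.
apply: measurable_fun_coorP => j.
case: (unliftP i j) => [k|] ->.
  under eq_fun do rewrite rV_ins_lift.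
  by apply: (measurableT_comp (measurable_coor k)); exact: measurable_snd.
under eq_fun do rewrite rV_insi.
exact: measurable_fst.
Qed.

Lemma ge0_integral_rV_ins n (i : 'I_n.+1) (f : 'rV[R]_n.+1 -> \bar R) :
  measurable_fun setT f -> (forall x, 0 <= f x) ->
  \int[leb_rV n.+1]_x f x = \int[leb]_s \int[leb_rV n]_x f (rV_ins i (s, x)).
Proof.
move=> mf f0.
rewrite (ge0_integral_lebesgue_rV_unique (mu :=
  (leb \x leb_rV n)) (measurable_rV_ins i))//.
  rewrite (fubini_tonelli1 (fun z => f (rV_ins i z)))//.
  by apply: measurableT_comp => //; exact: measurable_rV_ins.
move=> A mA; rewrite (bigD1_ord i)//=.
have -> : rV_ins i @^-1` (fun x : 'rV[R]_n.+1 => forall j, A j (x 0%R j)) =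
    (A i : set (measurableTypeR R)) `*`
    [set x : 'rV[R]_n | forall j : 'I_n, A (lift i j) (x 0%R j)].
  apply/seteqP; split => -[s x] /=.
    move=> H; split; first by have := H i; rewrite rV_insi.
    by move=> j; have := H (lift i j); rewrite rV_ins_lift.
  move=> [As Ax] j; case: (unliftP i j) => [k|] ->;
    by rewrite ?rV_ins_lift ?rV_insi.
rewrite product_measure1E//; last first.
- exact: (@measurable_rV_box _ _ (fun j => A (lift i j))).
- exact: mA.
by congr (_ * _); exact: (lebesgue_rV_box (fun j => mA (lift i j))).
Qed.

Lemma measurable_ge0_integral_rV_ins n (i : 'I_n.+1) (f : 'rV[R]_n.+1 ->
  \bar R) :
  measurable_fun setT f -> (forall x, 0 <= f x) ->
  measurable_fun setT (fun s : measurableTypeR R => \int[leb_rV n]_x f (rV_ins i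
    (s, x))).
Proof.
move=> mf f0; apply: (measurable_fun_fubini_tonelli_F (fun z => f (rV_ins i z)))
  => //.
by apply: measurableT_comp => //; exact: measurable_rV_ins.
Qed.

Definition flip n (s : 'I_n -> bool) (x : 'rV[R]_n) : 'rV[R]_n :=
  \row_i ((-1) ^+ s i * x 0 i)%R.

Lemma measurable_flip n (s : 'I_n -> bool) : measurable_fun setT (flip s).
Proof.
apply: measurable_fun_coorP => i; under eq_fun do rewrite mxE.
by apply: measurable_funM => //; exact: measurable_coor.
Qed.

Lemma ge0_integral_flip n (s : 'I_n -> bool) (f : 'rV[R]_n -> \bar R) :
  measurable_fun setT f -> (forall x, 0 <= f x) ->
  \int[leb_rV n]_x f (flip s x) = \int[leb_rV n]_x f x.
Proof.
move=> mf f0; apply/esym/ge0_integral_lebesgue_rV_unique => //.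
  exact: measurable_flip.
move=> A mA; pose B i := [set t : R | A i ((-1) ^+ s i * t)%R].
have BE i : B i = if s i then -%R @^-1` A i else A i.
  by apply/seteqP; rewrite /B; case: (s i); split => t /=;
    rewrite ?mulN1r ?mul1r.
have mB i : measurable (B i).
  rewrite BE; case: (s i) => //.
  by rewrite -[X in measurable X]setTI; apply: measurable_funN.
have -> : flip s @^-1` [set x | forall i, A i (x 0%R i)] =
    [set x | forall i, B i (x 0%R i)].
  by apply/seteqP; split => x /= H i; have := H i; rewrite /B /= mxE.
transitivity (\prod_(i < n) leb (B i)); first exact: lebesgue_rV_box.
apply: eq_bigr => i _; rewrite BE; case: (s i) => //.
exact: lebesgue_measureN.
Qed.

End lebesgue_rV_facts.

Section borel_rV.
Context {R : realType} {n : nat}.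

(** The sigma-algebra is generated by the coordinates, so an open set has to be written as a
    countable union of boxes: those with rational centre and half-side 1/(k+1) that it contains. *)
Lemma open_measurable_rV (U : set 'rV[R]_n) : open U -> measurable U.
Proof.
move=> oU.
pose B (qk : 'rV[rat]_n * nat) : set 'rV[R]_n := [set x | forall i,
  `]ratr (qk.1 0 i) - qk.2.+1%:R^-1, ratr (qk.1 0 i) + qk.2.+1%:R^-1[%classic (x
    0 i)].
have mB qk : measurable (B qk).
  by apply: (@measurable_rV_box _ _ (fun i => [set` `]_, _[%R])) => i.
suff -> : U = \bigcup_qk (if `[< B qk `<=` U >] then B qk else set0).
  apply: countable_bigcupT_measurable => [|qk]; first exact: countableP.
  by case: ifP => _; [exact: mB|exact: measurable0].
apply/seteqP; split => [x Ux|x [qk _]]; last by case: asboolP => // BU /BU.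
have /nbhs_ballP[e /= e0 eU] : nbhs x U by exact: open_nbhs_nbhs.
(* Two points of a box of half-side 1/(k+1) differ by less than 2/(k+1) < e in each coordinate. *)
pose k := Num.truncn (2 / e).
have ke : 2 * k.+1%:R^-1 < e.
  rewrite -ltr_pdivlMl// -[ltRHS]invrK ltf_pV2 ?posrE ?invr_gt0 ?mulr_gt0
    ?invr_gt0//.
  by rewrite invfM invrK truncnS_gt.
have k0 : 0 < k.+1%:R^-1 :> R by rewrite invr_gt0.
pose d : R := k.+1%:R^-1; have dE : k.+1%:R^-1 = d by [].
rewrite {}dE in ke k0; have dE : k.+1%:R^-1 = d by [].
have /choice[q qP] (i : 'I_n) : exists r : rat,
    ratr r \in `]x 0 i - d, x 0 i + d[%R.
  by apply: rat_in_itvoo; rewrite ltrD2l; move: (d) k0 => c; lra.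
exists (\row_i q i, k) => //; case: asboolP => [_|].
  move=> i; rewrite /= mxE dE; have := qP i; rewrite !in_itv/=.
  by move: (d) => c; lra.
case=> y By; apply: eU; split => // i j; rewrite ord1 /ball/=.
have := By j; have := qP j; rewrite /= mxE dE !in_itv/= ltr_norml.
by move: (d) ke k0 => c; lra.
Qed.

Lemma lower_semicontinuous_measurable_rV (f : 'rV[R]_n -> \bar R) :
  (forall a : R, open [set x | a%:E < f x]%E) -> measurable_fun setT f.
Proof.
move=> of_; apply: (measurability _ (ErealGenOInfty.measurableE R)).
move=> /= _ [_ [a ->]] <-; apply: measurableI => //; apply: open_measurable_rV.
by rewrite preimage_itvoy; exact: of_.
Qed.

Lemma continuous_measurable_rV (f : 'rV[R]_n -> R) :
  continuous f -> measurable_fun setT f.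
Proof.
move=> cf; apply/measurable_EFinP.
apply: lower_semicontinuous_measurable_rV => a.
rewrite [X in open X](_ : _ = f @^-1` [set y | a < y]).
  by apply: open_comp => [x _|]; [exact: cf|exact: open_gt].
by apply/seteqP; split => x /=; rewrite lte_fin.
Qed.

Lemma continuous_dotmul (x : 'rV[R]_n) : continuous (dotmul x).
Proof.
apply: continuous_big => [y|i _ y]; first exact: add_continuous.
by apply: continuousM; [exact: cst_continuous|exact: coord_continuous].
Qed.

(** A supremum of functions of y that are affine or constantly infinite is lower semicontinuous,
    whatever [Phi] is. Measurability in the symmetrization is recovered from this fact. *)
Lemma measurable_legendre (Phi : 'rV[R]_n -> \bar R) :
  measurable_fun setT (legendre Phi).
Proof.
apply: lower_semicontinuous_measurable_rV => a.
rewrite (_ : [set _ | _] =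
    \bigcup_x [set y | a%:E < (dotmul x y)%:E - Phi x]%E).
  apply: bigcup_open => x _.
  case: (Phi x) => [r| |].
  - rewrite [X in open X](_ : _ = dotmul x @^-1` [set t | a + r < t]).
      by apply: open_comp => [y _|]; [exact: continuous_dotmul|exact: open_gt].
    by apply/seteqP; split => y /=; rewrite -EFinB lte_fin ltrBrDr.
  - by rewrite [X in open X](_ : _ = set0)// -subset0 => y.
  - rewrite [X in open X](_ : _ = setT); first exact: openT.
    by rewrite -subTset => y _ /=; rewrite ltry.
apply/seteqP; split => y /=.
  by move=> /ereal_sup_gt[_ [x _ <-] ax]; exists x.
by move=> [x _ /= /lt_le_trans]; apply; apply: ereal_sup_ubound; exists x.
Qed.

End borel_rV.

Section prekopa_leindler_rV.
Context {R : realType}.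
Variables (a b : R) (T : R -> R -> R -> Prop).
Hypothesis PL : prekopa_leindler a b (@lebesgue_measure R) T.
Local Open Scope ereal_scope.

(** Tensorization: by the induction hypothesis the integrals over the slices satisfy the assumption
    of the one-dimensional inequality. In dimension 0 the measure is a point mass. *)
Lemma prekopa_leindler_rV n : prekopa_leindler a b (lebesgue_rV n)
  (fun x y z : 'rV[R]_n => forall i, T (x 0%R i) (y 0%R i) (z 0%R i)).
Proof.
elim: n => [|n ih] f g h mf mg mh f0 g0 h0 fgh.
  by rewrite /= !integral_dirac// !diracT !mul1e; apply: fgh => -[].
rewrite !(ge0_integral_rV_ins ord0)//; apply: PL; try
  by [exact: measurable_ge0_integral_rV_ins|move=> s; exact: integral_ge0].
move=> s t u stu.
have mins (k : 'rV[R]_n.+1 -> \bar R) r : measurable_fun setT k ->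
    measurable_fun setT (fun x => k (rV_ins ord0 (r, x))).
  move=> mk; apply: measurableT_comp => //.
  by apply: measurableT_comp;
    [exact: measurable_rV_ins|exact: measurable_pair1].
apply: ih => //; try exact: mins.
move=> x y z xyz; apply: fgh => i; case: (unliftP ord0 i) => [j|] ->.
  by rewrite !rV_ins_lift.
by rewrite !rV_insi.
Qed.

End prekopa_leindler_rV.

(** * The unconditional case *)

Section concave_slopes.
Context {R : realType} {n : nat}.
Local Notation D := (@nonneg_orthant R n).
Variable W : 'rV[R]_n -> R.
Hypothesis concW : concave_on D W.

Lemma concave_on_le (x y : 'rV[R]_n) (t : R) : D x -> D y -> 0 <= t -> t <= 1 ->
  t * W x + (1 - t) * W y <= W (t *: x + (1 - t) *: y).
Proof.
move=> Dx Dy t0 t1.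
have H : - W (t *: x + (1 - t) *: y) <= t * (- W x) + (1 - t) * (- W y).
  exact: (concW (Itv01 t0 t1) (mem_set Dx) (mem_set Dy)).
by lra.
Qed.

Lemma nonneg_orthantZ (t : R) x : 0 <= t -> D x -> D (t *: x).
Proof. by move=> t0 Dx i; rewrite mxE mulr_ge0. Qed.

Lemma nonneg_orthantD x y : D x -> D y -> D (x + y).
Proof. by move=> Dx Dy i; rewrite mxE addr_ge0. Qed.

(* One-sided, hence stable under sums of directions by concavity alone: partial
   derivatives bound a concave function without a multivariate chain rule. *)
Definition lower_slope (v h : 'rV[R]_n) (l : R) :=
  forall e, 0 < e -> exists2 d, 0 < d & forall t, 0 < t -> t < d ->
    D (v - t *: h) /\ W v - t * (l + e) <= W (v - t *: h).

(** The point v - t (h + h') is the midpoint of v - 2t h and v - 2t h', hence the doubled step and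
    the halved error. *)
Lemma lower_slopeD v h h' l l' :
  lower_slope v h l -> lower_slope v h' l' -> lower_slope v (h + h') (l + l').
Proof.
move=> H H' e e0.
have e20 : 0 < e / 2 by rewrite divr_gt0.
have [d d0 dP] := H _ e20; have [d' d'0 dP'] := H' _ e20.
exists (Num.min d d' / 2); first by rewrite divr_gt0// lt_min d0.
move=> t t0; rewrite ltr_pdivlMr// lt_min => /andP[td td'].
have t20 : 0 < t * 2 by rewrite mulr_gt0.
have [D1 W1] := dP _ t20 td; have [D2 W2] := dP' _ t20 td'.
have E : v - t *: (h + h') =
    2^-1 *: (v - (t * 2) *: h) + (1 - 2^-1) *: (v - (t * 2) *: h').
  by apply/rowP => i; rewrite !mxE; field.
have := @concave_on_le _ _ 2^-1 D1 D2; rewrite -E => /(_ _ _)W12.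
split.
  rewrite E; apply: nonneg_orthantD; apply: nonneg_orthantZ => //.
  by rewrite subr_ge0 invf_le1// ler1n.
have {}W12 : 2^-1 * W (v - (t * 2) *: h) + (1 - 2^-1) * W (v - (t * 2) *: h') <=
    W (v - t *: (h + h')).
  by apply: W12; rewrite ?invr_ge0// invf_le1// ler1n.
by nra.
Qed.

Lemma lower_slope0 v : D v -> lower_slope v 0 0.
Proof.
move=> Dv e e0; exists 1 => // t t0 _; rewrite scaler0 subr0; split => //.
by rewrite add0r gerBl mulr_ge0 ?ltW.
Qed.

Lemma lower_slope_sum v (h : 'I_n -> 'rV[R]_n) (l : 'I_n -> R) : D v ->
  (forall i, lower_slope v (h i) (l i)) ->
  lower_slope v (\sum_i h i) (\sum_i l i).
Proof.
move=> Dv H; elim/big_ind2 : _ => [|? ? ? ? ? ?|i _] //.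
  exact: lower_slope0.
exact: lower_slopeD.
Qed.

(** [v] lies between [u] and v - t (u - v), with weights t/(1+t) and 1/(1+t). If W u exceeded W v +
    l, taking half of the gap as error would contradict concavity. *)
Lemma lower_slope_le u v l : D u -> D v -> lower_slope v (u - v) l -> W u <=
  W v + l.
Proof.
move=> Du Dv H; rewrite leNgt; apply/negP => Wuv.
have e0 : 0 < (W u - W v - l) / 2 by move: Wuv; lra.
have [d d0 dP] := H _ e0.
have d20 : 0 < d / 2 by rewrite divr_gt0.
have [|Dt Wt] := dP _ d20; first by rewrite ltr_pdivrMr// ltr_pMr// ltr1n.
move: d20 Dt Wt; set t := d / 2 => t0 Dt Wt.
have t10 : 0 < 1 + t by rewrite addr_gt0.
pose s := t / (1 + t).
have sE : 1 - s = (1 + t)^-1 by rewrite /s; field; rewrite gt_eqF.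
have s0 : 0 <= s by rewrite divr_ge0 ?ltW.
have s1 : s <= 1 by rewrite -subr_ge0 sE invr_ge0 ltW.
have := concave_on_le Du Dt s0 s1.
have -> : s *: u + (1 - s) *: (v - t *: (u - v)) = v.
  by apply/rowP => i; rewrite sE /s !mxE; field; rewrite gt_eqF.
rewrite sE /s -(ler_pM2r t10).
have -> : (t / (1 + t) * W u + (1 + t)^-1 * W (v - t *: (u - v))) * (1 + t) =
  t * W u + W (v - t *: (u - v)) by field; rewrite gt_eqF.
move=> H1.
have : t * ((W u - W v - l) / 2) <= 0.
  by move: Wt H1; set w := W (_ - _) => Wt H1; nra.
by rewrite pmulr_rle0// leNgt e0.
Qed.

End concave_slopes.

Section axis_slopes.
Context {R : realType} {n : nat}.

Lemma is_derive_line (V : 'rV[R]_n -> R) (y e : 'rV[R]_n) :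
  derivable V y e -> is_derive (0 : R) 1 (fun t : R => V (y + t *: e)) ('D_e V
    y).
Proof.
move=> dV.
have E : (fun h : R => h^-1 *: (((fun t => V (y + t *: e)) \o shift 0) (h *: 1)
  -
      V (y + 0 *: e))) = (fun h => h^-1 *: ((V \o shift y) (h *: e) - V y)).
  apply/funext => h /=; rewrite addr0 scale0r addr0 [h *: 1]mulr1.
  by rewrite [y + _]addrC.
by apply: DeriveDef; rewrite /derivable /derive E.
Qed.

Lemma is_derive_lower (phi : R -> R) (c : R) : is_derive (0 : R) 1 phi c ->
  forall e, 0 < e -> exists2 d, 0 < d & forall t, 0 < t -> t < d ->
    phi 0 + t * (c - e) <= phi t.
Proof.
move=> [dphi phiE] e e0.
have : h^-1 *: ((phi \o shift 0) (h *: 1) - phi 0) @[h --> 0^'] --> c.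
  by rewrite -phiE; exact: dphi.
move=> /cvgrPdist_lt/(_ e e0); rewrite /prop_near1/= /fmap/= /dnbhs /within /=.
move=> /nbhs_ballP[d /= d0 dP]; exists d => // t t0 td.
have tN0 : t != 0 by rewrite gt_eqF.
have := dP t _ tN0; rewrite /ball /= sub0r normrN (gtr0_norm t0) => /(_ td).
rewrite addr0 /GRing.scale /= mulr1 ltr_norml => /andP[_].
rewrite ltrBlDr -ltrBlDl -(ltr_pM2l t0) mulrA mulfV// mul1r => /ltW.
by rewrite -lerBrDl.
Qed.

Variables (p : R) (V : 'rV[R]_n -> R).
Hypotheses (p1 : 1 < p) (C1V : C1 V) (uncV : unconditional V).

Let p0 : 0 < p. Proof. exact: lt_trans p1. Qed.
Let W (u : 'rV[R]_n) := V (\row_i (u 0 i `^ p^-1)).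

Definition sgn_vec (y : 'rV[R]_n) (i : 'I_n) : bool := y 0 i < 0.

Lemma sgn_vecK y i : (-1) ^+ sgn_vec y i * `|y 0 i| = y 0 i.
Proof.
rewrite /sgn_vec; case: ltrP => yi; first by rewrite ltr0_norm// mulN1r opprK.
by rewrite mul1r ger0_norm.
Qed.

Lemma sgn_vec_mul y i : (-1) ^+ sgn_vec y i * y 0 i = `|y 0 i|.
Proof.
rewrite /sgn_vec; case: ltrP => yi; first by rewrite ltr0_norm// mulN1r.
by rewrite mul1r ger0_norm.
Qed.

(** Along e_i only one coordinate of the p-th root moves, and unconditionality restores the signs of
    [y]: the function to differentiate is V (y + psi(t) e_i), a one-variable chain rule. The root is
    differentiable there because y_i is not 0. *)
Lemma lower_slope_axis (y : 'rV[R]_n) (i : 'I_n) (r : R) : y 0 i != 0 ->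
  lower_slope W (\row_j (`|y 0 j| `^ p)) (r *: basis_vec i)
    (r * (p^-1 * `|y 0 i| `^ (1 - p) * ((-1) ^+ sgn_vec y i * partial i V y))).
Proof.
move=> yi; set v := \row_j _; set sg : R := (-1) ^+ sgn_vec y i.
have yi0 : 0 < `|y 0 i| by rewrite normr_gt0.
have vi : v 0 i = `|y 0 i| `^ p by rewrite mxE.
have vi0 : 0 < v 0 i by rewrite vi powR_gt0.
have root j : (`|y 0 j| `^ p) `^ p^-1 = `|y 0 j|.
  by rewrite -powRrM mulfV ?gt_eqF// powRr1.
pose psi (t : R) := sg * (v 0 i - t * r) `^ p^-1 - y 0 i.
pose phi := (fun t => V (y + t *: basis_vec i)) \o psi.
have psi0 : psi 0 = 0 by rewrite /psi mul0r subr0 vi root sgn_vecK subrr.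
have WE (t : R) : W (v - t *: (r *: basis_vec i)) = phi t.
  rewrite /W -(uncV (sgn_vec y)); congr V; apply/rowP => j; rewrite !mxE/=.
  have [->|ij] := eqVneq j i.
    by rewrite !mulr1 /psi vi [RHS]addrC subrK.
  by rewrite !mulr0 subr0 addr0 root sgn_vecK.
have phi' : is_derive (0 : R) 1 phi
    (partial i V y * (sg * ((p^-1 * (v 0 i - 0 * r) `^ (p^-1 - 1)) * - r))).
  apply: is_derive1_comp.
    by rewrite psi0; apply: is_derive_line; case: (C1V i).
  have d1 : is_derive (0 : R) 1 (fun t : R => v 0 i - t * r) (- r).
    by apply: is_derive_eq; rewrite /GRing.scale/=; ring.
  have d2 : is_derive (0 : R) 1 ((@powR R)^~ p^-1 \o (fun t :
    R => v 0 i - t * r))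
      (p^-1 * (v 0 i - 0 * r) `^ (p^-1 - 1) * - r).
    by apply: is_derive1_comp; apply: is_derive1_powR; rewrite mul0r subr0.
  have d3 : is_derive (0 : R) 1 (sg \*: ((@powR R)^~ p^-1 \o (fun t :
    R => v 0 i - t * r)))
      (sg *: (p^-1 * (v 0 i - 0 * r) `^ (p^-1 - 1) * - r)).
    exact: is_deriveZ.
  have := is_deriveB d3 (is_derive_cst (y 0 i) (0 : R) (1 : R)).
  by rewrite subr0.
move=> e e0; have [d d0 dP] := is_derive_lower phi' e0.
have r10 : 0 < `|r| + 1 by rewrite ltr_wpDl.
(* The second bound keeps v_i - t r nonnegative; the added 1 covers r = 0. *)
exists (Num.min d (v 0 i / (`|r| + 1))); first by rewrite lt_min d0 divr_gt0.
move=> t t0; rewrite lt_min => /andP[td]; rewrite ltr_pdivlMr// => tv.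
split.
  move=> j; rewrite !mxE eqxx /=; have [->|_] := eqVneq j i;
    last by rewrite !mulr0 subr0 powR_ge0.
  rewrite mulr1 -vi subr_ge0; apply: ltW; apply: le_lt_trans tv.
  by rewrite ler_pM2l// (le_trans (ler_norm _))// lerDl.
have -> : W v = phi 0 by rewrite -WE scale0r subr0.
rewrite WE; apply: le_trans (dP _ t0 td); rewrite le_eqVlt; apply/orP; left;
  apply/eqP.
rewrite mul0r subr0 vi -powRrM.
have -> : p * (p^-1 - 1) = 1 - p by field; rewrite gt_eqF.
by ring.
Qed.

End axis_slopes.

Section young.
Context {R : realType} {n : nat}.
Variables (p : R) (V : 'rV[R]_n -> R).
Hypotheses (p1 : 1 < p) (contV : continuous V) (C1V : C1 V) (uncV :
  unconditional V).
Hypothesis homV : homogeneous p V.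
Hypothesis concV : concave_on nonneg_orthant
  (fun x : 'rV[R]_n => V (\row_i (x 0 i `^ p^-1))).

Let p0 : 0 < p. Proof. exact: lt_trans p1. Qed.
Let pV0 : 0 < p^-1. Proof. by rewrite invr_gt0. Qed.
Let W (u : 'rV[R]_n) := V (\row_i (u 0 i `^ p^-1)).

Let WZ (t : R) u : 0 <= t -> nonneg_orthant u -> W (t *: u) = t * W u.
Proof.
move=> t0 Du; rewrite /W -[in RHS](powRr1 t0) -(@mulVf _ p) ?gt_eqF// powRrM.
rewrite -homV ?powR_ge0//; congr V; apply/rowP => i.
by rewrite !mxE powRM.
Qed.

(* The slope bound for W(u) = V(u^(1/p)) at v = |y|^p reads
   W u <= W v + l u - l v; taking u = 2 v gives W v <= l v. *)
Lemma concave_homogeneous_le (y z : 'rV[R]_n) : (forall i, y 0 i != 0) ->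
  V z <= \sum_i `|z 0 i| `^ p *
    (p^-1 * `|y 0 i| `^ (1 - p) * ((-1) ^+ sgn_vec y i * partial i V y)).
Proof.
move=> y0; pose c i := p^-1 * `|y 0 i| `^ (1 - p) * ((-1) ^+ sgn_vec y i *
  partial i V y).
pose v : 'rV[R]_n := \row_j (`|y 0 j| `^ p).
pose u : 'rV[R]_n := \row_j (`|z 0 j| `^ p).
have Dv : nonneg_orthant v by move=> i; rewrite mxE powR_ge0.
have Du : nonneg_orthant u by move=> i; rewrite mxE powR_ge0.
have key w : nonneg_orthant w -> W w <= W v + \sum_i (w - v) 0 i * c i.
  move=> Dw; apply: (lower_slope_le concV Dw Dv).
  rewrite {1}[w - v]row_sum_delta; apply: (lower_slope_sum concV Dv) => i.
  exact: lower_slope_axis.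
have Wv : W v <= \sum_i v 0 i * c i.
  have := key (2 *: v); rewrite WZ// => /(_ (nonneg_orthantZ (ler0n _ 2) Dv)).
  have -> : 2 *: v - v = v by rewrite scaler_nat mulr2n addrK.
  by lra.
have -> : V z = W u.
  rewrite -(uncV (sgn_vec z)); congr V; apply/rowP => i; rewrite !mxE.
  rewrite -powRrM mulfV ?gt_eqF// powRr1//.
  exact: sgn_vec_mul.
apply: le_trans (key _ Du) _.
have -> : \sum_i (u - v) 0 i * c i = \sum_i u 0 i * c i - \sum_i v 0 i * c i.
  by rewrite -sumrB; apply: eq_bigr => i _; rewrite !mxE mulrBl.
have -> : \sum_i u 0 i * c i = \sum_i `|z 0 i| `^ p * c i.
  by apply: eq_bigr => i _; rewrite mxE.
by lra.
Qed.

(** Here |z_i|^p = |x_i| |y_i|^(p-1), whose power of |y_i| cancels the one in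
    [concave_homogeneous_le]. The flip gives [x] the signs of [y]. *)
Lemma geometric_young (x y z : 'rV[R]_n) : (forall i, y 0 i != 0) ->
  (forall i, `|z 0 i| = `|x 0 i| `^ p^-1 * `|y 0 i| `^ (1 - p^-1)) ->
  exists s : 'I_n -> bool, p * V z <= dotmul (flip s x) (grad V y).
Proof.
move=> y0 zxy; exists (fun i => sgn_vec x i (+) sgn_vec y i).
rewrite -ler_pdivlMl//; apply: le_trans (concave_homogeneous_le z y0) _.
rewrite /dotmul mulr_sumr le_eqVlt; apply/orP; left; apply/eqP.
apply: eq_bigr => i _; rewrite !mxE zxy.
rewrite powRM ?powR_ge0// -!powRrM mulVf ?gt_eqF// powRr1//.
have -> : (1 - p^-1) * p = p - 1 by field; rewrite gt_eqF.
have yi0 : 0 < `|y 0 i| by rewrite normr_gt0.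
have yy : `|y 0 i| `^ (p - 1) * `|y 0 i| `^ (1 - p) = 1.
  rewrite -powRD; last by apply/implyP => _; rewrite gt_eqF.
  by rewrite -opprB addNr powRr0.
rewrite signr_addb -[in RHS](sgn_vecK x i) !mulrA.
rewrite [_ * (-1) ^+ sgn_vec y i * (-1) ^+ sgn_vec x i]mulrAC.
set s1 := (-1) ^+ sgn_vec x i; set s2 := (-1) ^+ sgn_vec y i.
have s11 : s1 * s1 = 1 by rewrite -signr_addb addbb.
transitivity (p^-1 * (`|y 0 i| `^ (p - 1) * `|y 0 i| `^ (1 - p)) *
  `|x 0 i| * s2 * partial i V y); first by ring.
transitivity (p^-1 * (s1 * s1) * `|x 0 i| * s2 * partial i V y); last by ring.
by rewrite yy s11.
Qed.

Local Open Scope ereal_scope.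

Lemma legendre_ge (Phi : 'rV[R]_n -> \bar R) x y :
  (dotmul x y)%:E - Phi x <= legendre Phi y.
Proof. by apply: ereal_sup_ubound; exists x. Qed.

Lemma poweR_expeR (x : \bar R) (r : R) : (0 < r)%R ->
  expeR x `^ r = expeR (r%:E * x).
Proof.
move=> r0; case: x => [x| |] /=.
- by rewrite -expRM mulrC.
- by rewrite gt_eqF// gt0_muley// lte_fin.
- by rewrite powR0 ?gt_eqF// gt0_muleNy ?lte_fin.
Qed.

Lemma weighted_santalo_unconditional (Phi : 'rV[R]_n -> \bar R) :
  unconditional Phi -> weighted_santalo p V Phi.
Proof.
move=> uncPhi; rewrite /weighted_santalo.
set If := \int[_]_x expeR (- Phi x); set Ig := \int[_]_x expeR (- (_ * _)).
set Ih := \int[_]_x expeR (- (V x)%:E).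
have If0 : 0 <= If by apply: integral_ge0 => x _; exact: expeR_ge0.
have Ig0 : 0 <= Ig by apply: integral_ge0 => x _; exact: expeR_ge0.
have Ih0 : 0 <= Ih by apply: integral_ge0 => x _; exact: expeR_ge0.
have b0 : (0 < 1 - p^-1)%R by rewrite subr_gt0 invf_lt1.
have ab1 : (p^-1 + (1 - p^-1) = 1)%R by rewrite addrC subrK.
(* The p-th root of the claim has exponents 1/p and 1 - 1/p, which add up to 1. *)
suff H : If `^ p^-1 * Ig `^ (1 - p^-1) <= Ih.
  have -> : If * Ig `^ (p - 1) = (If `^ p^-1 * Ig `^ (1 - p^-1)) `^ p.
    rewrite poweRM ?poweR_ge0// -!poweRrM mulVf ?gt_eqF// poweRe1//.
    by congr (_ * _ `^ _); field; rewrite gt_eqF.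
  apply: gt0_ler_poweR => //; rewrite ?in_itv/= ?leey ?andbT//.
    exact: ltW.
  by rewrite mule_ge0// poweR_ge0.
have PL := prekopa_leindler_rV (prekopa_leindler_line_geometric pV0 b0 ab1) (n
  := n).
apply: (prekopa_leindler_inner pV0 b0 ab1 PL); try by move=> x;
  exact: expeR_ge0.
  apply/measurable_EFinP; apply: measurableT_comp => //; apply: measurable_funN.
  exact: continuous_measurable_rV.
move=> x y z xyz; rewrite !poweR_expeR// -expeRD lee_expeR.
have y0 i : y 0%R i != 0%R by case: (xyz i).
have zxy i : `|z 0 i|%R = (`|x 0 i| `^ p^-1 * `|y 0 i| `^ (1 - p^-1))%R.
  by case: (xyz i).
have [s Hs] := geometric_young y0 zxy.
have := legendre_ge Phi (flip s x) (grad V y).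
rewrite {2}/flip uncPhi.
have c0 : (0 < (p - 1)^-1)%R by rewrite invr_gt0 subr_gt0.
have E1 : p^-1%:E * -oo = -oo by rewrite gt0_muleNy// lte_fin.
have E2 : (p - 1)^-1%:E * +oo = +oo by rewrite gt0_muley// lte_fin.
have E3 : (1 - p^-1)%:E * -oo = -oo by rewrite gt0_muleNy// lte_fin.
(* An infinite value either contradicts [legendre_ge] or makes the exponent on the left equal to
   -oo, since +oo + (-oo) = -oo. *)
case: (Phi x) => [r| |]; case: (legendre Phi (grad V y)) => [l| |] //=;
  rewrite ?E1 ?E2 /= ?E3 ?addeNy ?addNye ?leNye//.
rewrite !lee_fin => rl.
(* The factor 1/(p-1) in the second integrand is the one that gives [Phi] and its transform the same
   coefficient 1/p. *)
have c : ((1 - p^-1) * - ((p - 1)^-1 * l) = p^-1 * (- l))%R.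
  by field; rewrite !gt_eqF// subr_gt0.
by rewrite c -mulrDr ler_pdivrMl//; lra.
Qed.
End young.

(** * Symmetrization and the even case *)

Section flips.
Context {R : realType} {n : nat}.

Definition flip_invariant {T : Type} (s : 'I_n -> bool) (f : 'rV[R]_n -> T) :=
  forall x, f (flip s x) = f x.

Lemma flipK (s : 'I_n -> bool) : involutive (@flip R n s).
Proof. by move=> x; apply/rowP => i; rewrite !mxE mulrA -signr_addb addbb mul1r.
Qed.

Lemma flipC (s t : 'I_n -> bool) (x : 'rV[R]_n) : flip s (flip t x) =
  flip t (flip s x).
Proof. by apply/rowP => i; rewrite !mxE mulrCA. Qed.

Lemma flipD (s : 'I_n -> bool) (x y : 'rV[R]_n) : flip s (x + y) =
  flip s x + flip s y.
Proof. by apply/rowP => i; rewrite !mxE mulrDr. Qed.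

Lemma flip_basis (s : 'I_n -> bool) (t : R) i :
  flip s (t *: basis_vec i) = ((-1) ^+ s i * t) *: basis_vec i.
Proof.
apply/rowP => j; rewrite !mxE; have [->|_] := eqVneq j i;
  first by rewrite !mulr1.
by rewrite !mulr0.
Qed.

Lemma flipT (x : 'rV[R]_n) : flip xpredT x = - x.
Proof. by apply/rowP => i; rewrite !mxE mulN1r. Qed.

Lemma dotmul_flip (s : 'I_n -> bool) (x y : 'rV[R]_n) :
  dotmul (flip s x) y = dotmul x (flip s y).
Proof. by apply: eq_bigr => i _; rewrite !mxE mulrA [_ * x 0 i]mulrC. Qed.

Lemma flip_invariant_unconditional T (f : 'rV[R]_n -> T) :
  (forall i, flip_invariant (pred1 i) f) -> unconditional f.
Proof.
move=> H s x; rewrite -/(flip s x).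
suff key k : (k <= n)%N -> f (flip (fun j => s j && (j < k)%N) x) = f x.
  rewrite -[RHS](key n)//; congr f; apply/rowP => j.
  by rewrite !mxE ltn_ord andbT.
elim: k => [|k ih] kn.
  by congr f; apply/rowP => j; rewrite !mxE ltn0 andbF mul1r.
have kn' := ltnW kn; rewrite -(ih kn'); pose i := Ordinal kn.
case si : (s i); last first.
  congr f; apply/rowP => j; rewrite !mxE ltnS leq_eqVlt.
  have [jk|] := eqVneq (j : nat) k => //=.
  by have -> : j = i; [exact: val_inj|rewrite si].
rewrite -[RHS](H i); congr f; apply/rowP => j; rewrite !mxE /= ltnS leq_eqVlt.
rewrite -val_eqE /=; have [jk|_] /= := eqVneq (j : nat) k;
  last by rewrite mul1r.
by have -> : j = i; [exact: val_inj|rewrite si /= ltnn /= mul1r].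
Qed.

End flips.

Section legendre_facts.
Context {R : realType} {n : nat}.
Implicit Types (Phi b : 'rV[R]_n -> \bar R).
Local Open Scope ereal_scope.

Lemma leeB_swap (r : R) (x y : \bar R) : (r%:E - x <= y) = (r%:E - y <= x).
Proof.
case: x => [x| |]; case: y => [y| |] //=; rewrite ?leey ?leNye ?lexx//.
by rewrite -!EFinB !lee_fin !lerBlDr addrC.
Qed.

Lemma dotmulC (x y : 'rV[R]_n) : dotmul x y = dotmul y x.
Proof. by apply: eq_bigr => i _; rewrite mulrC. Qed.

Lemma legendre_le Phi y (c : \bar R) :
  (forall x, (dotmul x y)%:E - Phi x <= c) -> legendre Phi y <= c.
Proof. by move=> H; apply: ge_ereal_sup => _ [x _ <-]. Qed.

Lemma legendre_gtNy Phi x y : Phi x < +oo -> -oo < legendre Phi y.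
Proof.
move=> Px; apply: lt_le_trans (legendre_ge Phi x y).
by case: (Phi x) Px => [r| |]//= _; rewrite -EFinB ltNyr.
Qed.

Lemma legendre_legendre_le Phi x : legendre (legendre Phi) x <= Phi x.
Proof.
apply: legendre_le => y; rewrite leeB_swap dotmulC; exact: legendre_ge.
Qed.

Lemma flip_invariant_legendre s Phi : flip_invariant s Phi ->
  flip_invariant s (legendre Phi).
Proof.
move=> inv; have H y : legendre Phi (flip s y) <= legendre Phi y.
  apply: legendre_le => x; rewrite -dotmul_flip -inv; exact: legendre_ge.
by move=> y; apply/le_anti; rewrite H -{1}(flipK s y) H.
Qed.

(* The i-th coordinates t1 = t + y_i and t2 = t - y_i of the two points run over
   all the pairs with t1 - t2 = 2 y_i. *)
Definition symmetral (i : 'I_n) b (y : 'rV[R]_n) : \bar R :=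
  ereal_inf (range (fun t : R => 2^-1%:E *
    (b (y + t *: basis_vec i)%R + b (flip (pred1 i) y + t *: basis_vec i)%R))).

Lemma symmetral_le i b y t : symmetral i b y <= 2^-1%:E *
  (b (y + t *: basis_vec i)%R + b (flip (pred1 i) y + t *: basis_vec i)%R).
Proof. by apply: ereal_inf_lbound; exists t. Qed.

Lemma flip_invariant_symmetral s i b : flip_invariant s b ->
  flip_invariant s (symmetral i b).
Proof.
move=> inv; have H y : symmetral i b y <= symmetral i b (flip s y).
  apply: le_ereal_inf_tmp => _ [t _ <-].
  apply: le_trans (symmetral_le i b y ((-1) ^+ s i * t)%R) _.
  by rewrite -flip_basis -(inv (y + _)%R) -(inv (_ y + _)%R) !flipD flipK flipC.
by move=> y; apply/le_anti; rewrite H -{2}(flipK s y) H.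
Qed.

Lemma flip_invariant_symmetral1 i b : flip_invariant (pred1 i) (symmetral i b).
Proof.
move=> y; rewrite /symmetral flipK; congr ereal_inf.
by apply: eq_imagel => t _; rewrite addeC.
Qed.

(** For y1 = y + t e_i and y2 = flip y + t e_i, the opposite i-th coordinates of [x1] and [x2]
    cancel t, so that the pairing of y with the left-hand point is the average of <y1, x1> and <y2,
    x2>. *)
Lemma legendre_symmetral_le i b (x1 x2 : 'rV[R]_n) : (forall y, -oo < b y) ->
  (x1 0 i = - x2 0 i)%R ->
  legendre (symmetral i b) (2^-1 *: (x1 + flip (pred1 i) x2))%R <=
  2^-1%:E * (legendre b x1 + legendre b x2).
Proof.
move=> bNy x12; apply: legendre_le => y; rewrite leeB_swap.
apply: le_ereal_inf_tmp => _ [t _ <-].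
set y1 := (y + t *: _)%R; set y2 := (flip _ y + t *: _)%R.
have := legendre_ge b y1 x1; have := legendre_ge b y2 x2.
have E : (dotmul y (2^-1 *: (x1 + flip (pred1 i) x2)) =
    2^-1 * (dotmul y1 x1 + dotmul y2 x2))%R.
  rewrite /dotmul -big_split mulr_sumr /= (bigD1 i)//= [RHS](bigD1 i)//=.
  congr (_ + _)%R; last first.
    by apply: eq_bigr => j ji; rewrite !mxE eqxx /= (negPf ji) /=; ring.
  by rewrite !mxE !eqxx /= x12; ring.
rewrite {}E; have := bNy y1; have := bNy y2.
have half_gt0 : 0 < 2^-1%:E :> \bar R by rewrite lte_fin invr_gt0.
case: (b y1) => [b1| |]// ; case: (b y2) => [b2| |]// _ _;
  rewrite ?addey ?addye// ?(gt0_muley half_gt0) ?leey//.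
case: (legendre b x1) => [l1| |]//; case: (legendre b x2) => [l2| |]//;
  rewrite ?addey ?addye// ?(gt0_muley half_gt0) /= ?leNye//.
by rewrite !lee_fin; lra.
Qed.

Lemma expeR_half_le (u v w : \bar R) (c : R) : -oo < u -> -oo < v ->
  (0 < c)%R ->
  w <= 2^-1%:E * (u + v) ->
  expeR (- (c%:E * u)) `^ 2^-1 * expeR (- (c%:E * v)) `^ 2^-1 <=
    expeR (- (c%:E * w)).
Proof.
move=> uNy vNy c0 wuv.
have h0 : (0 < 2^-1 :> R)%R by rewrite invr_gt0.
have Ec : c%:E * +oo = +oo by rewrite gt0_muley// lte_fin.
have EcN : c%:E * -oo = -oo by rewrite gt0_muleNy// lte_fin.
have Eh : 2^-1%:E * -oo = -oo :> \bar R by rewrite gt0_muleNy// lte_fin.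
have EhP : 2^-1%:E * +oo = +oo :> \bar R by rewrite gt0_muley// lte_fin.
rewrite !poweR_expeR// -expeRD lee_expeR.
case: u uNy wuv => [u| |]//; case: v vNy => [v| |]//; case: w => [w| |]// _ _;
  rewrite ?Ec ?EcN /= ?Eh ?EhP ?addey ?addye ?addeNy ?addNye ?leNye ?leey//.
rewrite !lee_fin => wuv.
by have := ler_wpM2l (ltW c0) wuv; lra.
Qed.

End legendre_facts.

Section symmetral_integrals.
Context {R : realType}.
Local Open Scope ereal_scope.
Local Notation leb := (@lebesgue_measure R).
Local Notation leb_rV := (@lebesgue_rV R).

Let h0 : (0 < 2^-1 :> R)%R. Proof. by rewrite invr_gt0. Qed.
Let hh : (2^-1 + 2^-1 = 1 :> R)%R. Proof. by field. Qed.

Lemma poweR_half_mul (x : \bar R) : 0 <= x -> x `^ 2^-1 * x `^ 2^-1 = x.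
Proof.
rewrite le_eqVlt => /predU1P[<-|x0].
  by rewrite poweR0r ?mul0e// gt_eqF.
rewrite -poweRD ?hh ?poweRe1 ?ltW//.
by apply: nneg_neq0_poweRD_def; rewrite ?gt_eqF// ltW.
Qed.

Lemma rV_ins_add n (i : 'I_n.+1) (s t : R) (x : 'rV[R]_n) :
  (rV_ins i (s, x) + t *: basis_vec i = rV_ins i (s + t, x))%R.
Proof.
apply/rowP => j; rewrite !mxE /=; case: unliftP => [k|] ->.
  by rewrite [lift i k == i]eq_sym (negPf (neq_lift _ _)) mulr0 addr0.
by rewrite eqxx mulr1.
Qed.

Lemma flip_rV_ins n (i : 'I_n.+1) (s : R) (x : 'rV[R]_n) :
  flip (pred1 i) (rV_ins i (s, x)) = rV_ins i (- s, x)%R.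
Proof.
apply/rowP => j; rewrite !mxE /=; case: unliftP => [k|] ->.
  by rewrite [lift i k == i]eq_sym (negPf (neq_lift _ _)) mul1r.
by rewrite eqxx mulN1r.
Qed.

Lemma measurable_expeR : measurable_fun setT (@expeR R).
Proof.
apply: (measurability _ (ErealGenOInfty.measurableE R)).
move=> /= _ [_ [a ->]] <-; rewrite setTI preimage_itvoy.
have [a0|a0] := ltP a 0%R.
  rewrite (_ : [set _ | _] = setT); first exact: measurableT.
  by rewrite -subTset => x _ /=; apply: lt_le_trans (expeR_ge0 x);
    rewrite lte_fin.
have [y ya] := @expeR_total _ a%:E a0.
rewrite [X in measurable X](_ : _ = setT `&` [set x | y < x]).
  by apply: emeasurable_fun_lt.
by apply/seteqP; split => x /=; rewrite -ya lte_expeR; [|case].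
Qed.

Lemma measurable_expe n (f : 'rV[R]_n -> \bar R) (c : R) :
  measurable_fun setT f ->
  measurable_fun setT (fun x => expeR (- (c%:E * f x))).
Proof.
move=> mf; apply: measurableT_comp => //; first exact: measurable_expeR.
by apply: measurableT_comp => //; exact: measurable_funeM.
Qed.

(* The Prekopa-Leindler inequality on the slice x_i = s, whose other factor, on
   x_i = - s, has the same integral because legendre b is even. *)
Lemma integral_legendre_symmetral n (i : 'I_n.+1) (b a' : 'rV[R]_n.+1 ->
  \bar R) :
  flip_invariant xpredT b -> (forall y, -oo < b y) ->
  (exists y, b y < +oo) ->
  measurable_fun setT a' -> (forall x, a' x <= legendre (symmetral i b) x) ->
  \int[leb_rV n.+1]_x expeR (- legendre b x) <= \int[leb_rV n.+1]_x expeR (- a'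
    x).
Proof.
move=> evb bNy [y0 by0] ma' a'le.
pose F x := expeR (- (1%:E * legendre b x)).
pose G x := expeR (- (1%:E * a' x)).
have -> : \int[leb_rV n.+1]_x expeR (- legendre b x) = \int[leb_rV n.+1]_x F x.
  by apply: eq_integral => x _; rewrite /F mul1e.
have -> : \int[leb_rV n.+1]_x expeR (- a' x) = \int[leb_rV n.+1]_x G x.
  by apply: eq_integral => x _; rewrite /G mul1e.
have mF : measurable_fun setT F by apply: measurable_expe;
  exact: measurable_legendre.
have mG : measurable_fun setT G by exact: measurable_expe.
have F0 x : 0 <= F x by exact: expeR_ge0.
have G0 x : 0 <= G x by exact: expeR_ge0.
rewrite !(ge0_integral_rV_ins i)//; apply: ge0_le_integralT => s.
  exact: integral_ge0.
have mins (k : 'rV[R]_n.+1 -> \bar R) r : measurable_fun setT k ->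
    measurable_fun setT (fun x => k (rV_ins i (r, x))).
  move=> mk; apply: measurableT_comp => //.
  by apply: measurableT_comp;
    [exact: measurable_rV_ins|exact: measurable_pair1].
have evF x : F (rV_ins i (- s, x)%R) = F (rV_ins i (s, flip xpredT x)).
  rewrite /F -(flip_invariant_legendre evb);
    congr (expeR (- (_ * legendre _ _))).
  apply/rowP => j; rewrite !mxE /=; case: unliftP => [k|] _; rewrite ?mxE//.
  by rewrite mulN1r opprK.
rewrite -[leLHS]poweR_half_mul; last exact: integral_ge0.
rewrite -{2}(ge0_integral_flip xpredT (mins _ s mF))//.
under [X in _ * X `^ _]eq_integral do rewrite -evF.
apply: (prekopa_leindler_rV (prekopa_leindler_line h0 h0 hh)) => //;
  try exact: mins.
move=> x y z xyz; apply: expeR_half_le => //.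
- exact: legendre_gtNy by0.
- exact: legendre_gtNy by0.
apply: le_trans (a'le _) _; apply: le_trans; last first.
  by apply: (legendre_symmetral_le (i := i)) => //; rewrite !rV_insi /= opprK.
rewrite flip_rV_ins opprK le_eqVlt; apply/orP; left; apply/eqP.
congr (legendre _ _); apply/rowP => j; rewrite !mxE /=; case: unliftP => [k|] _.
  by rewrite xyz mulrDr.
by rewrite -mulr2n -[(s *+ 2)%R]mulr_natl mulKf// gt_eqF.
Qed.

(* By the layer cake formula it suffices to integrate over {D > t}, which meets
   each line parallel to the i-th axis in a centred interval. *)
Lemma integral_symmetral_weight n (i : 'I_n.+1) (b b' D : 'rV[R]_n.+1 ->
  \bar R) (c : R) :
  (0 < c)%R -> (forall y, -oo < b y) ->
  measurable_fun setT b -> measurable_fun setT b' -> measurable_fun setT D ->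
  (forall y, 0 <= D y) ->
  (forall x (r s : R), (`|r| <= `|s|)%R -> D (rV_ins i (s, x)) <=
    D (rV_ins i (r, x))) ->
  (forall y, b' y <= symmetral i b y) ->
  \int[leb_rV n.+1]_x (expeR (- (c%:E * b x)) * D x) <=
  \int[leb_rV n.+1]_x (expeR (- (c%:E * b' x)) * D x).
Proof.
move=> c0 bNy mb mb' mD D0 Ddec b'le.
pose F x := expeR (- (c%:E * b x)); pose G x := expeR (- (c%:E * b' x)).
have mF : measurable_fun setT F by exact: measurable_expe.
have mG : measurable_fun setT G by exact: measurable_expe.
have F0 x : 0 <= F x by exact: expeR_ge0.
have G0 x : 0 <= G x by exact: expeR_ge0.
rewrite (layer_cake (leb_rV n.+1) mD mF)// (layer_cake (leb_rV n.+1) mD mG)//.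
apply: ge0_le_integralT => t; first exact: integral_ge0.
rewrite integral_mkcond [leRHS]integral_mkcond.
set L := [set _ | _].
have mL : measurable L by exact: measurable_superlevel.
have restr (H : 'rV[R]_n.+1 -> \bar R) : measurable_fun setT H ->
  (forall x, 0 <= H x) ->
    [/\ measurable_fun setT (H \_ L), (forall x, 0 <= (H \_ L) x) &
    \int[leb_rV n.+1]_x (H \_ L) x =
    \int[leb_rV n]_x \int[leb]_s (H \_ L) (rV_ins i (s, x))].
  move=> mH H0.
  have mHL : measurable_fun setT (H \_ L).
    by apply/(measurable_restrictT _ mL); exact: measurable_funTS.
  have HL0 x : 0 <= (H \_ L) x by exact: erestrict_ge0.
  split => //; rewrite (ge0_integral_rV_ins i)//.
  rewrite (fubini_tonelli (fun z => (H \_ L) (rV_ins i z)))//.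
  by apply: measurableT_comp => //; exact: measurable_rV_ins.
have [mFL FL0 ->] := restr F mF F0; have [mGL GL0 ->] := restr G mG G0.
apply: ge0_le_integralT => x; first exact: integral_ge0.
have mins (k : 'rV[R]_n.+1 -> \bar R) : measurable_fun setT k ->
    measurable_fun setT (fun s : measurableTypeR R => k (rV_ins i (s, x))).
  move=> mk; apply: measurableT_comp => //.
  by apply: measurableT_comp;
    [exact: measurable_rV_ins|exact: measurable_pair2].
have mu := mins _ mFL.
have muN : measurable_fun setT (fun s : measurableTypeR R => (F \_ L) (rV_ins i
  (- s, x)%R)).
  apply: (measurableT_comp mu); exact: measurable_funN.
have reflect : \int[leb]_s (F \_ L) (rV_ins i (- s, x)%R) =
    \int[leb]_s (F \_ L) (rV_ins i (s, x)).
  have mN : measurable_fun setT (fun s : measurableTypeR R => (- s :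
    measurableTypeR R)%R).
    exact: measurable_funN.
  rewrite -(ge0_integral_pushforward mN leb measurableT mu)//.
  by apply: eq_measure_integral => A mA _; exact: lebesgue_measureN.
rewrite -[leLHS]poweR_half_mul; last exact: integral_ge0.
(* The reflection pairs the points s and -r, whose half-difference is the mean (s + r)/2. *)
rewrite -{2}reflect.
apply: (prekopa_leindler_line h0 h0 hh) => //; first exact: mins.
move=> s r z ->; rewrite !patchE.
have zero (y : \bar R) : 0 `^ 2^-1 * y `^ 2^-1 = 0.
  by rewrite poweR0r ?mul0e// gt_eqF.
case: ifPn => [/set_mem Ls|_]; last by rewrite zero; case: ifP.
case: ifPn => [/set_mem Lr|_]; last first.
  by rewrite muleC zero; case: ifP.
set q := rV_ins i (2^-1 * s + 2^-1 * r, x)%R.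
(* The mean is at most max(|s|, |r|) in absolute value, so it stays in the centred interval. *)
have Lq : L q.
  case: Ls Lr => t0 Ls [_ Lr]; split => //.
  have [rs|sr] := leP `|r|%R `|s|%R.
    apply: lt_le_trans Ls _; apply: Ddec; apply: le_trans (ler_normD _ _) _.
    by rewrite !normrM (ger0_norm (ltW h0)); lra.
  apply: lt_le_trans Lr _; apply: Ddec; apply: le_trans (ler_normD _ _) _.
  by rewrite !normrM (ger0_norm (ltW h0)) normrN; lra.
rewrite (mem_set Lq); apply: expeR_half_le => //.
apply: le_trans (b'le _) _.
(* This shift carries the i-th coordinates (s + r)/2 and -(s + r)/2 to s and -r. *)
apply: le_trans (symmetral_le i b q (2^-1 * (s - r))%R) _.
rewrite /q flip_rV_ins !rV_ins_add le_eqVlt; apply/orP; left; apply/eqP.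
by congr (_ * (b (rV_ins i (_, x)) + b (rV_ins i (_, x)))); field.
Qed.

End symmetral_integrals.

Section iterated_symmetral.
Context {R : realType} {n : nat}.
Variables (D : 'rV[R]_n.+1 -> \bar R) (c : R).
Hypotheses (c0 : 0 < c) (mD : measurable_fun setT D) (D0 : forall y, (0 <=
  D y)%E).
Hypothesis Ddec : forall i x (r s : R), `|r| <= `|s| ->
  (D (rV_ins i (s, x)) <= D (rV_ins i (r, x)))%E.
Local Open Scope ereal_scope.
Local Notation leb_rV := (@lebesgue_rV R).

Definition admissible (b : 'rV[R]_n.+1 -> \bar R) :=
  [/\ measurable_fun setT b, flip_invariant xpredT b, (forall y, -oo < b y),
      (exists y, b y < +oo) & (exists x, legendre b x < +oo)].

Definition dominated (b b' : 'rV[R]_n.+1 -> \bar R) :=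
  \int[leb_rV n.+1]_x expeR (- legendre b x) <=
    \int[leb_rV n.+1]_x expeR (- legendre b' x) /\
  \int[leb_rV n.+1]_x (expeR (- (c%:E * b x)) * D x) <=
    \int[leb_rV n.+1]_x (expeR (- (c%:E * b' x)) * D x).

(** The new function is L (L (S_i b)): an infimum over all real t is not visibly measurable, a
    Legendre transform is. It lies below S_i b and its own transform lies below L (S_i b), so both
    integrals can only grow. *)
Lemma symmetral_step (i : 'I_n.+1) b : admissible b ->
  exists b', [/\ admissible b', dominated b b', flip_invariant (pred1 i) b' &
    forall s, flip_invariant s b -> flip_invariant s b'].
Proof.
move=> [mb evb bNy [y0 by0] [x0 Lx0]].
have Lev := flip_invariant_legendre evb.
pose a := legendre (symmetral i b); exists (legendre a).
have half x : x < +oo -> 2^-1%:E * (x + x) < +oo :> \bar R.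
  case: x => [x| |]// _; rewrite ?ltry// gt0_muleNy ?ltNyr// lte_fin invr_gt0//.
have [x1 ax1] : exists x, a x < +oo.
  (* The slice inequality for x0 and -x0, at which L b has the same finite upper bound by
     evenness. *)
  exists (2^-1 *: (x0 + flip (pred1 i) (flip xpredT x0)))%R.
  apply: le_lt_trans (legendre_symmetral_le bNy _) _.
    by rewrite !mxE mulN1r opprK.
  by rewrite Lev half.
have b'le y : legendre a y <= symmetral i b y by exact: legendre_legendre_le.
have Lb'le x : legendre (legendre a) x <= a x by exact: legendre_legendre_le.
have inv s : flip_invariant s b -> flip_invariant s (legendre a).
  by move=> sb; do 2 apply: flip_invariant_legendre;
    exact: flip_invariant_symmetral.
split => //.
- split; [exact: measurable_legendre|exact: inv|by move=> y;
  exact: legendre_gtNy ax1| |].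
  (* The projection of y0 to the hyperplane y_i = 0: for t = y0_i both points in the symmetral are
     y0. *)
  + exists (y0 + (- y0 0 i) *: basis_vec i)%R.
    apply: le_lt_trans (b'le _) _; apply: le_lt_trans (symmetral_le _ _ _ (y0
      0%R i)) _.
    set y1 := (y0 + _)%R.
    have E : flip (pred1 i) y1 = y1.
      apply/rowP => j; rewrite !mxE /=; have [->|_] := eqVneq j i.
        by rewrite mulr1 subrr mulr0.
      by rewrite mul1r.
    have -> : (flip (pred1 i) y1 + y0 0 i *: basis_vec i = y0)%R.
      by rewrite E -addrA -scalerDl addNr scale0r addr0.
    by rewrite -addrA -scalerDl addNr scale0r addr0 half.
  + by exists x1; apply: le_lt_trans (Lb'le _) _.
- split.
    apply: (integral_legendre_symmetral (i := i)) => //; first by exists y0.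
    exact: measurable_legendre.
  apply: (integral_symmetral_weight (i := i)) => //; last exact: Ddec.
  exact: measurable_legendre.
- by do 2 apply: flip_invariant_legendre; exact: flip_invariant_symmetral1.
Qed.

(** A step in one coordinate keeps the flip invariances already gained, so a single pass over the
    coordinates suffices. *)
Lemma iterated_symmetral b : admissible b ->
  exists b', dominated b b' /\ unconditional b'.
Proof.
move=> adb.
suff key k : (k <= n.+1)%N -> exists b', [/\ admissible b', dominated b b' &
    forall i : 'I_n.+1, (i < k)%N -> flip_invariant (pred1 i) b'].
  have [b' [_ domb' inv]] := key n.+1 (leqnn _).
  by exists b'; split => //; apply: flip_invariant_unconditional => i;
    exact: inv.
elim: k => [|k ih] kn.
  by exists b; split => //; split.
have [b1 [ad1 [dom1 dom1'] inv1]] := ih (ltnW kn).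
have [b2 [ad2 [dom2 dom2'] inv2 inv12]] := symmetral_step (Ordinal kn) ad1.
exists b2; split => //;
  first by split; [exact: le_trans dom2|exact: le_trans dom2'].
move=> i; rewrite ltnS leq_eqVlt => /orP[/eqP ik|ik].
  by have -> : i = Ordinal kn by exact: val_inj.
by apply: inv12; exact: inv1.
Qed.

End iterated_symmetral.

(** * The image of Lebesgue measure under the gradient *)

Section gradient_density.
Context {R : realType} {n : nat}.
Variable V : 'rV[R]_n -> R.
Hypotheses (C1V : C1 V) (uncV : unconditional V).
Variable D : 'rV[R]_n -> \bar R.
Hypotheses (mD : measurable_fun setT D) (D0 : forall y, (0 <= D y)%E).
Hypothesis densD : forall A : set 'rV[R]_n, measurable A ->
  pushforward (lebesgue_rV n) (grad V) A = (\int[lebesgue_rV n]_(y in A) D y)%E.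

Lemma grad_flip s (x : 'rV[R]_n) : grad V (flip s x) = flip s (grad V x).
Proof.
apply/rowP => i; rewrite !mxE; have dV y : derivable V y (basis_vec i)
  by case: (C1V i).
have d1 := is_derive_line (dV (flip s x)).
have lin : is_derive (0 : R) 1 (fun t : R => (-1) ^+ s i * t) ((-1) ^+ s i).
  by apply: is_derive_eq; rewrite /GRing.scale/=; ring.
have d2 : is_derive (0 : R) 1
    ((fun t : R => V (x + t *: basis_vec i)) \o (fun t : R => (-1) ^+ s i * t))
    (partial i V x * (-1) ^+ s i).
  by apply: is_derive1_comp; rewrite mulr0; exact: is_derive_line.
have E : (fun t : R => V (flip s x + t *: basis_vec i)) =
    (fun t : R => V (x + t *: basis_vec i)) \o (fun t : R => (-1) ^+ s i * t).
  apply/funext => t /=; rewrite -[RHS](uncV s) -/(flip s _) flipD flip_basis.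
  by rewrite mulrA -signr_addb addbb mul1r.
rewrite {1}E in d1; rewrite mulrC.
by rewrite /partial -(@derive_val _ _ _ _ _ _ _ d1) (@derive_val _ _ _ _ _ _ _
  d2).
Qed.

Lemma measurable_grad : measurable_fun setT (grad V).
Proof.
apply: measurable_fun_coorP => i; under eq_fun do rewrite mxE.
by apply: continuous_measurable_rV; case: (C1V i).
Qed.

Definition abs_rV (y : 'rV[R]_n) : 'rV[R]_n := \row_i `|y 0 i|.

Lemma measurable_abs_rV : measurable_fun setT abs_rV.
Proof.
apply: measurable_fun_coorP => i; under eq_fun do rewrite mxE.
by apply: measurableT_comp => //; exact: measurable_coor.
Qed.

Lemma flip_sgn_vec y : flip (sgn_vec y) y = abs_rV y.
Proof. by apply/rowP => i; rewrite !mxE sgn_vec_mul. Qed.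

Local Open Scope ereal_scope.
Local Notation leb_rV := (lebesgue_rV n).

(** The measure with density [D] is invariant because grad V commutes with flips, which preserve
    Lebesgue measure; nothing is claimed about [D] at single points. *)
Lemma integral_density_flip s (A : set 'rV[R]_n) : measurable A ->
  \int[leb_rV]_(y in A) D y = \int[leb_rV]_(y in A) D (flip s y).
Proof.
move=> mA.
have mfA : measurable (flip s @^-1` A).
  by rewrite -[X in measurable X]setTI; exact: measurable_flip.
transitivity (\int[leb_rV]_(y in flip s @^-1` A) D y).
  rewrite -!densD// /pushforward.
  have mG B : measurable B -> measurable (grad V @^-1` B).
    by move=> mB; rewrite -[X in measurable X]setTI; exact: measurable_grad.
  have ind (B : set 'rV[R]_n) : measurable B -> leb_rV B =
    \int[leb_rV]_x (\1_B x)%:E.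
    by move=> mB; rewrite integral_indic// setIT.
  rewrite !ind; [|exact: mG|exact: mG].
  rewrite -[LHS](ge0_integral_flip s); last 2 first.
  - by apply/measurable_EFinP; apply: measurable_indic; exact: mG.
  - by move=> x; rewrite lee_fin.
  apply: eq_integral => x _; rewrite !indicE; congr (nat_of_bool _)%:R%:E.
  by apply/idP/idP; rewrite !inE /= grad_flip.
rewrite integral_mkcond [RHS]integral_mkcond.
rewrite -[LHS](ge0_integral_flip s); last 2 first.
- by apply/(measurable_restrictT _ mfA); exact: measurable_funTS.
- by move=> x; exact: erestrict_ge0.
apply: eq_integral => x _; rewrite !patchE.
by congr (if _ then _ else _); apply/idP/idP; rewrite !inE /= flipK.
Qed.

(* The density need not be unconditional; on each orthant it is compared with
   its reflection to the positive one. *)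
Lemma integral_density_abs (A : set 'rV[R]_n) : measurable A ->
  \int[leb_rV]_(y in A) D y = \int[leb_rV]_(y in A) D (abs_rV y).
Proof.
move=> mA.
pose O (s : {ffun 'I_n -> bool}) := [set y : 'rV[R]_n | forall i, sgn_vec y i =
  s i].
have mO s : measurable (O s).
  have -> : O s = [set y | forall i, [set t : R | (t < 0)%R = s i] (y 0%R i)]
    by [].
  apply: (@measurable_rV_box _ _ (fun i => [set t : R | (t < 0)%R = s i])) => i.
  case: (s i).
    rewrite (_ : [set _ | _] = `]-oo, 0%R[%classic);
      first exact: measurable_itv.
    by apply/seteqP; split => t; rewrite /= in_itv.
  rewrite (_ : [set _ | _] = `[0%R, +oo[%classic); first exact: measurable_itv.
  by apply/seteqP; split => t; rewrite /= in_itv/= andbT leNgt;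
    [move=> ->|move=> /negPf].
have split_ (E : 'rV[R]_n -> \bar R) : measurable_fun setT E -> (forall x, 0 <=
  E x) ->
    \int[leb_rV]_(y in A) E y = \sum_(s : {ffun 'I_n ->
      bool}) \int[leb_rV]_(y in A `&` O s) E y.
  move=> mE E0.
  under [RHS]eq_bigr do rewrite integral_mkcond.
  rewrite -ge0_integral_sum//; last 2 first.
  - move=> s; apply/(measurable_restrictT _ (measurableI _ _ mA (mO s))).
    exact: measurable_funTS.
  - by move=> s x _; exact: erestrict_ge0.
  rewrite [LHS]integral_mkcond; apply: eq_integral => y _; rewrite patchE.
  rewrite (bigD1 [ffun i => sgn_vec y i])//= big1 ?adde0; last first.
    move=> s sy; rewrite patchE memNset// => -[_ ys].
    by move/eqP: sy; apply; apply/ffunP => i; rewrite ffunE ys.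
  rewrite patchE; congr (if _ then _ else _); apply/idP/idP; rewrite !inE.
    by move=> Ay; split => // i; rewrite ffunE.
  by case.
rewrite !split_//.
- apply: eq_bigr => s _; rewrite (integral_density_flip s);
  last exact: measurableI.
  apply: eq_integral => y /set_mem[_ ys]; congr D.
  by rewrite -flip_sgn_vec; apply/rowP => i; rewrite !mxE ys.
- by apply: measurableT_comp => //; exact: measurable_abs_rV.
Qed.

(** The layer cake formula extends [densD] from sets to functions. The weight is put in the form
    that depends on |y| only, as the symmetrization requires. *)
Lemma ge0_integral_grad (g : 'rV[R]_n -> \bar R) :
  measurable_fun setT g -> (forall x, 0 <= g x) ->
  \int[leb_rV]_x g (grad V x) = \int[leb_rV]_y (g y * D (abs_rV y)).
Proof.
move=> mg g0.
have mgV : measurable_fun setT (g \o grad V).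
  by apply: measurableT_comp => //; exact: measurable_grad.
have mDa : measurable_fun setT (D \o abs_rV).
  by apply: measurableT_comp => //; exact: measurable_abs_rV.
transitivity (\int[leb_rV]_x (1 * (g \o grad V) x)).
  by apply: eq_integral => x _; rewrite mul1e.
rewrite (layer_cake leb_rV mgV (measurable_cst 1))//;
  last by move=> x; exact: g0.
transitivity (\int[leb_rV]_x ((D \o abs_rV) x * g x)); last first.
  by apply: eq_integral => x _; rewrite muleC.
rewrite (layer_cake leb_rV mg mDa)//; last by move=> x; exact: D0.
apply: eq_integral => t _.
have mL : measurable [set x | (0 < t)%R /\ t%:E < g x]
  by exact: measurable_superlevel.
rewrite -integral_density_abs// -densD// integral_cst ?mul1e//.
exact: (measurable_superlevel mgV).
Qed.

End gradient_density.

Theorem theorem1 (R : realType) (n : nat) (p : R) (V : 'rV[R]_n -> R) :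
  1 < p ->
  even_fun V -> strictly_convex V -> homogeneous p V -> C2 V ->
  unconditional V ->
  concave_on nonneg_orthant
    (fun x : 'rV[R]_n => V (\row_i (x 0 i `^ p^-1))) ->
  (forall Phi : 'rV[R]_n -> \bar R,
     unconditional Phi -> proper_convex Phi -> weighted_santalo p V Phi) /\
  (forall D : 'rV[R]_n -> \bar R,
     is_det_hessian_legendre V D ->
     decreasing_off_coordinate_hyperplanes D ->
     forall Phi : 'rV[R]_n -> \bar R,
       even_fun Phi -> proper_convex Phi -> weighted_santalo p V Phi).
Proof.
move=> p1 _ _ homV [contV [C1V _]] uncV concV.
have part1 Phi : unconditional Phi -> weighted_santalo p V Phi.
  exact: weighted_santalo_unconditional.
split; first by move=> Phi uncPhi _; exact: part1.
move=> D [mD D0 _ densD] decD Phi evPhi [PhiNy [x0 Phix0] _].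
case: n V homV contV C1V uncV concV part1 D mD D0 densD decD Phi evPhi PhiNy x0
  Phix0
  => [|n] V homV contV C1V uncV concV part1 D mD D0 densD decD Phi evPhi PhiNy
    x0 Phix0.
  (* On R^0 there is no coordinate, so every function is unconditional. *)
  by apply: part1 => s x; congr Phi; apply/rowP => -[].
have c0 : 0 < (p - 1)^-1 by rewrite invr_gt0 subr_gt0.
have p10 : 0 <= p - 1 by rewrite subr_ge0 ltW.
have p1N0 : p - 1 != 0 by rewrite gt_eqF// subr_gt0.
pose c := (p - 1)^-1; pose b := legendre Phi.
(* If [b] is +oo everywhere, the second integral is 0, and so is its power because p - 1 > 0. *)
have [[y0 by0]|nb] := pselect (exists y, (b y < +oo)%E); last first.
  rewrite /weighted_santalo [X in (_ * X `^ _)%E]integral0_eq.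
    by rewrite poweR0r// mule0 poweR_ge0.
  move=> x _; have -> : legendre Phi (grad V x) = +oo%E.
    apply/eqP; rewrite -leye_eq leNgt; apply/negP => bx.
    by apply: nb; exists (grad V x).
  by rewrite gt0_muley ?lte_fin.
have Ddec i x (r s : R) : `|r| <= `|s| ->
    ((D \o abs_rV) (rV_ins i (s, x)) <= (D \o abs_rV) (rV_ins i (r, x)))%E.
  move=> rs; have E (t : R) : abs_rV (rV_ins i (t, x)) =
      rV_ins i (0, abs_rV x) + `|t| *: basis_vec i.
    rewrite rV_ins_add add0r; apply/rowP => j; rewrite !mxE /=.
    by case: unliftP => [k|] _; rewrite ?mxE.
  by rewrite /= !E; apply: decD => //; rewrite rV_insi.
have mDa : measurable_fun setT (D \o @abs_rV R n.+1).
  by apply: measurableT_comp => //; exact: measurable_abs_rV.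
have adb : admissible b.
  split.
  - exact: measurable_legendre.
  - by apply: flip_invariant_legendre => x; rewrite flipT.
  - by move=> y; exact: legendre_gtNy Phix0.
  - by exists y0.
  - by exists x0; apply: le_lt_trans (legendre_legendre_le Phi x0) Phix0.
have [b' [[le1 le2] uncb']] := iterated_symmetral c0 mDa (fun y => D0 _) Ddec
  adb.
have uncLb' : unconditional (legendre b').
  by move=> s x; apply: flip_invariant_legendre => y; exact: uncb'.
(* The unconditional case is applied to L b'. The first factor grows through L b <= Phi, the second
   through L (L b') <= b'. *)
apply: le_trans (part1 _ uncLb').
have transfer Psi : (\int[lebesgue_rV n.+1]_x
      expeR (- (c%:E * legendre Psi (grad V x))) =
    \int[lebesgue_rV n.+1]_y (expeR (- (c%:E * legendre Psi y)) * D (abs_rV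
      y)))%E.
  apply: (ge0_integral_grad C1V uncV mD D0 densD
    (g := fun y => expeR (- (c%:E * legendre Psi y)))%E) => //.
    by apply: measurable_expe; exact: measurable_legendre.
  by move=> y; exact: expeR_ge0.
apply: lee_pmul.
- by apply: integral_ge0 => x _; exact: expeR_ge0.
- exact: poweR_ge0.
- apply: le_trans le1; apply: ge0_le_integralT => x; first exact: expeR_ge0.
  by rewrite lee_expeR leeN2; exact: legendre_legendre_le.
apply: gt0_ler_poweR => //.
- by rewrite in_itv/= leey andbT; apply: integral_ge0 => x _; exact: expeR_ge0.
- by rewrite in_itv/= leey andbT; apply: integral_ge0 => x _; exact: expeR_ge0.
rewrite !transfer; apply: le_trans le2 _; apply: ge0_le_integralT => y.
  by rewrite mule_ge0// ?expeR_ge0// D0.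
rewrite lee_wpmul2r ?D0// lee_expeR leeN2 lee_pmul2l ?lte_fin//.
exact: legendre_legendre_le.
Qed.
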